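(* Let $\tilde f$ and $\tilde g$ satisfy Assumption A, let $\gamma^\nu\in(0,1]$ satisfy $\lim_{\nu\to\infty}\gamma^\nu=0$ and $\sum_{\nu=0}^\infty\gamma^\nu=\infty$, let $x^0\in K$, and let $\{x^\nu\}$ be the (infinite) sequence generated by the DSM algorithm. Then the whole sequence $\{x^\nu\}$ is contained in $K$, and either $\{x^\nu\}$ is unbounded or the following assertions hold: (i) at least one limit point $\hat x$ of $\{x^\nu\}$ is a (generalized) stationary solution of problem (P); in particular, if the eMFCQ holds at $\hat x$, then $\hat x$ is a KKT solution of problem (P); (ii) if, in addition, the eMFCQ holds at every limit point of $\{x^\nu\}$ and Assumption B holds, then every limit point of $\{x^\nu\}$ is a KKT solution of problem (P).
   Context: **Problem.** $K\subseteq\mathbb R^n$ is nonempty, closed and convex; $f:\mathbb R^n\to\mathbb R$, $g:\mathbb R^n\to\mathbb R^m$, $h:\mathbb R^n\to\mathbb R^p$ are $C^{1,1}$ (continuously differentiable with locally Lipschitz gradients) on an open set containing $K$; $q:\mathbb R^n\to\mathbb R$ is convex on $K$ and locally Lipschitz continuous on an open set containing $K$. Problem (P): minimize $f(x)+q(x)$ subject to $g(x)\le 0$, $h(x)=0$, $x\in K$. **Notation.** $\nabla g(x)\in\mathbb R^{n\times m}$, $\nabla h(x)\in\mathbb R^{n\times p}$ are transposed Jacobians; $\alpha_+=\max\{0,\alpha\}$; $e^m$ is the all-ones vector of $\mathbb R^m$; $\mathbb B^p_\infty$ is the closed unit ball of $\|\cdot\|_\infty$ in $\mathbb R^p$; $N_C(x)$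 is the normal cone to a convex set $C$ at $x$; $\partial q(x)$ is the subdifferential of $q$ at $x\in K$ in the sense of convex analysis, $\{v: q(y)\ge q(x)+v^T(y-x)\ \forall y\in K\}$; $\|\cdot\|$ is the Euclidean norm. Put $\varphi(x)=\max_{i,j}\{g_i(x)_+,|h_j(x)|\}$. A limit point of a sequence is a limit of some subsequence. **Stationarity.** Define $M_1(x)=\{(\xi,\pi): \xi\in N_{\mathbb R^m_-}(g(x)),\ h(x)=0,\ 0\in\nabla f(x)+\partial q(x)+\nabla g(x)\xi+\nabla h(x)\pi+N_K(x)\}$, $M_0(x)=\{(\xi,\pi): \xi\in N_{\mathbb R^m_-}(g(x)-\varphi(x)e^m),\ \pi\in N_{\varphi(x)\mathbb B^p_\infty}(h(x)),\ 0\in\nabla g(x)\xi+\nabla h(x)\pi+N_K(x)\}$. A point $\hat x\in K$ is: a KKT solution of (P) if $g(\hat x)\le0$, $h(\hat x)=0$, $M_1(\hat x)\ne\emptyset$; a Fritz-John (FJ) solution if $g(\hat x)\le 0$, $h(\hat x)=0$, $M_0(\hat x)\neq\{0\}$; an External Stationary (ES) solution if $g_i(\hat x)>0$ for some $i$ or $h_j(\hat x)\ne0$ for some $j$, and $M_0(\hat x)\ne\{0\}$. It is a (generalized) stationary solution if any of these occurs. The eMFCQ holds at $\hat x\in K$ if $M_0(\hat x)=\{0\}$. **Subproblem.** Fix $\beta>0$, $\rho\in(0,\beta)$, $\lambda\in(0,1)$. Let $\tilde h(d;x)=h(x)+\nabla h(x)^Td$, and for $x\in K$ $$\kappa(x)=(1-\lambda)\varphi(x)+\lambda\min_d\Big\{\max_{i,j}\{\tilde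 g_i(d;x)_+,|\tilde h_j(d;x)|\}\ :\ \|d\|_\infty\le\rho,\ d\in K-x\Big\}.$$ For $x\in K$, $d(x)$ is the unique solution of (P$_x$): minimize over $d$ the function $\tilde f(d;x)+q(x+d)$ subject to $\tilde g(d;x)\le\kappa(x)e^m$, $-\kappa(x)e^p\le\tilde h(d;x)\le\kappa(x)e^p$, $\|d\|_\infty\le\beta$, $d\in K-x$. **Assumption A.** $O_d$ and $O_x$ are open neighborhoods of $\beta\mathbb B^n_\infty$ and $K$; $\tilde f:O_d\times O_x\to\mathbb R$ and $\tilde g_i:\mathbb R^n\times O_x\to\mathbb R$ ($i=1,\dots,m$) are continuously differentiable on $O_d$ with respect to the first argument (partial gradient denoted $\nabla_1$), and: A1) $\tilde f(\cdot;x)$ is strongly convex on $O_d$ for every $x\in K$ with modulus $c>0$ independent of $x$; A2) $\tilde f$ is continuous on $O_d\times O_x$; A3) $\nabla_1\tilde f$ is continuous on $O_d\times O_x$; A4) $\nabla_1\tilde f(0;x)=\nabla f(x)$ for $x\in K$; A5) $\tilde g_i(\cdot;x)$ is convex on $O_d$ for $x\in K$; A6) $\tilde g_i$ is continuous on $\mathbb R^n\times O_x$; A7) $\tilde g_i(0;x)=g_i(x)$ for $x\in K$; A8) $\nabla_1\tilde g_i$ is continuous on $O_d\times O_x$; A9) $\nabla_1\tilde g_i(0;x)=\nabla g_i(x)$ for $x\in K$. **Assumption B.** For any compact $S\subseteq K$ there are positive constants $\mu,\alpha$ such that $\|d(y)-d(z)\|\le\mu\|y-z\|^\alpha$ for all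 $y,z\in S$. **DSM algorithm.** Start from $x^0\in K$. At iteration $\nu=0,1,\dots$: if $x^\nu$ is a generalized stationary solution of (P), stop; otherwise compute $\kappa(x^\nu)$ and $d(x^\nu)$, and set $x^{\nu+1}=x^\nu+\gamma^\nu d(x^\nu)$. The sequence considered is infinite, i.e. the algorithm does not stop (no $x^\nu$ is generalized stationary). *)

(* Defs.v *)
From HB Require Import structures.
From mathcomp Require Import all_boot all_order all_algebra.
From mathcomp Require Import all_classical all_reals all_analysis.
Import Order.TTheory GRing.Theory Num.Theory.
Import numFieldNormedType.Exports.

Set Implicit Arguments.
Unset Strict Implicit.
Unset Printing Implicit Defensive.

Local Open Scope classical_set_scope.
Local Open Scope convex_scope.
Local Open Scope ring_scope.

(* Vectors of R^n are row vectors.  The library norm `|v| of v : 'rV[R]_n is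
   the max norm, so it is used wherever the norm is the max norm; the Euclidean
   norm is [enorm].  The library Jacobian 'J F x of F : R^n -> R^k is the
   n x k matrix acting on row vectors by d |-> d *m 'J F x, that is, the
   transposed Jacobian \nabla F(x). *)

Section vectors.
Context {R : realType}.

Definition dotv n (u v : 'rV[R]_n) : R := \sum_i u 0 i * v 0 i.

Definition enorm n (u : 'rV[R]_n) : R := Num.sqrt (dotv u u).

Definition grad n (f : 'rV[R]_n -> R) (x : 'rV[R]_n) : 'rV[R]_n :=
  \row_i 'D_(delta_mx 0 i) f x.

Definition locally_lipschitz_on (V W : normedModType R) (U : set V)
    (F : V -> W) : Prop :=
  forall x, U x -> exists2 N, nbhs x N & [lipschitz F y | y in N `&` U].

Definition C1_on n (U : set 'rV[R]_n) (f : 'rV[R]_n -> R) : Prop :=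
  (forall x, U x -> differentiable f x) /\ {within U, continuous (grad f)}.

Definition C11_on n (U : set 'rV[R]_n) (f : 'rV[R]_n -> R) : Prop :=
  C1_on U f /\ locally_lipschitz_on U (grad f).

Definition C11_map_on n k (U : set 'rV[R]_n) (F : 'rV[R]_n -> 'rV[R]_k) :
    Prop :=
  [/\ forall x, U x -> differentiable F x,
      {within U, continuous (jacobian F)} &
      locally_lipschitz_on U (jacobian F)].

Definition strongly_convex_function n (c : R) (C : set 'rV[R]_n)
    (f : 'rV[R]_n -> R) : Prop :=
  forall t : R, 0 <= t <= 1 -> forall y z, C y -> C z ->
    f (t *: y + (1 - t) *: z) <=
      t * f y + (1 - t) * f z - c / 2 * t * (1 - t) * enorm (y - z) ^+ 2.

(* The open set on which the approximations are (strongly) convex is not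
   assumed to be convex: there, convexity is understood on its convex
   subsets. *)
Definition convex_on n (D : set 'rV[R]_n) (f : 'rV[R]_n -> R) : Prop :=
  forall C : set 'rV[R]_n, C `<=` D -> convex_set C -> convex_function C f.

Definition strongly_convex_on n (c : R) (D : set 'rV[R]_n)
    (f : 'rV[R]_n -> R) : Prop :=
  forall C : set 'rV[R]_n, C `<=` D -> convex_set C ->
    strongly_convex_function c C f.

(* Empty when x is not in C. *)
Definition normal_cone n (C : set 'rV[R]_n) (x : 'rV[R]_n) : set 'rV[R]_n :=
  [set v | C x /\ forall y, C y -> dotv v (y - x) <= 0].

Definition subdifferential n (K : set 'rV[R]_n) (q : 'rV[R]_n -> R)
    (x : 'rV[R]_n) : set 'rV[R]_n :=
  [set v | K x /\ forall y, K y -> q x + dotv v (y - x) <= q y].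

Definition nonpos_orthant m : set 'rV[R]_m := [set u | forall i, u 0 i <= 0].

Definition unit_ball_inf p : set 'rV[R]_p := [set u | `|u| <= 1].

Definition scale_set p (r : R) (B : set 'rV[R]_p) : set 'rV[R]_p :=
  [set r *: u | u in B].

(* max over i, j of (u_i)_+ and |v_j|, equal to 0 if m = p = 0 *)
Definition max_violation m p (u : 'rV[R]_m) (v : 'rV[R]_p) : R :=
  Num.max (\big[Num.max/0]_(i < m) Num.max 0 (u 0 i))
          (\big[Num.max/0]_(j < p) `|v 0 j|).

Definition is_min (A : set R) (a : R) : Prop := A a /\ lbound A a.

Definition set_min (A : set R) : R := get (is_min A).

Definition subseq_limit n (x : nat -> 'rV[R]_n) (l : 'rV[R]_n) : Prop :=
  exists2 s : nat -> nat, {homo s : i j / (i < j)%N} & x \o s @ \oo --> l.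

End vectors.

Section stationarity.
Context {R : realType} {n m p : nat}.
Variables (K : set 'rV[R]_n) (f q : 'rV[R]_n -> R).
Variables (g : 'rV[R]_n -> 'rV[R]_m) (h : 'rV[R]_n -> 'rV[R]_p).
Implicit Type x : 'rV[R]_n.

Definition phi x : R := max_violation (g x) (h x).

(* xi *m ('J g x)^T is the row vector of \nabla g(x) xi, and likewise for h. *)
Definition M1 x : set ('rV[R]_m * 'rV[R]_p) :=
  [set z | [/\ normal_cone (nonpos_orthant (m := m)) (g x) z.1,
    h x = 0 &
    exists v w, [/\ subdifferential K q x v, normal_cone K x w &
      0 = grad f x + v + z.1 *m ('J g x)^T + z.2 *m ('J h x)^T + w]]].

Definition M0 x : set ('rV[R]_m * 'rV[R]_p) :=
  [set z | [/\
    normal_cone (nonpos_orthant (m := m)) (g x - const_mx (phi x)) z.1,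
    normal_cone (scale_set (phi x) (unit_ball_inf (p := p))) (h x) z.2 &
    exists2 w, normal_cone K x w &
      0 = z.1 *m ('J g x)^T + z.2 *m ('J h x)^T + w]].

Definition feasible x : Prop := (forall i, g x 0 i <= 0) /\ h x = 0.

Definition KKT x : Prop := [/\ K x, feasible x & M1 x !=set0].

Definition FJ x : Prop := [/\ K x, feasible x & M0 x <> [set (0, 0)]].

Definition ES x : Prop :=
  [/\ K x, (exists i, 0 < g x 0 i) \/ (exists j, h x 0 j <> 0) &
      M0 x <> [set (0, 0)]].

Definition stationary x : Prop := [\/ KKT x, FJ x | ES x].

Definition eMFCQ x : Prop := K x /\ M0 x = [set (0, 0)].

End stationarity.

Section algorithm.
Context {R : realType} {n m p : nat}.
Variables (K : set 'rV[R]_n) (f q : 'rV[R]_n -> R).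
Variables (g : 'rV[R]_n -> 'rV[R]_m) (h : 'rV[R]_n -> 'rV[R]_p).
(* The approximations are written [ft d x] and [gt d x]; their values outside
   their domains of definition are irrelevant. *)
Variables (ft : 'rV[R]_n -> 'rV[R]_n -> R).
Variables (gt : 'rV[R]_n -> 'rV[R]_n -> 'rV[R]_m).
Variables (beta rho lambda : R).
Implicit Types d x : 'rV[R]_n.

Definition ht d x : 'rV[R]_p := h x + d *m 'J h x.

(* d \in K - x is expressed as x + d \in K. *)
Definition kappa x : R :=
  (1 - lambda) * phi g h x +
  lambda * set_min [set max_violation (gt d x) (ht d x) |
                      d in [set d | `|d| <= rho /\ K (x + d)]].

Definition sub_feasible x : set 'rV[R]_n :=
  [set d | [/\ forall i, gt d x 0 i <= kappa x,
               forall j, - kappa x <= ht d x 0 j <= kappa x,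
               `|d| <= beta & K (x + d)]].

Definition sub_solution x : set 'rV[R]_n :=
  [set d | sub_feasible x d /\
    forall d', sub_feasible x d' -> ft d x + q (x + d) <= ft d' x + q (x + d')].

(* Existence and uniqueness of the solution are not part of the definition;
   they are consequences of the assumptions on the data and on ft, gt. *)
Definition dsol x : 'rV[R]_n := get (sub_solution x).

Record assumptionA (Od Ox : set 'rV[R]_n) : Prop := AssumptionA {
  A_Od_open : open Od;
  A_Od_ball : [set d | `|d| <= beta] `<=` Od;
  A_Ox_open : open Ox;
  A_Ox_K : K `<=` Ox;
  A_ft_C1 : forall x, Ox x -> C1_on Od (ft ^~ x);
  A_gt_C1 : forall x i, Ox x -> C1_on Od (fun d => gt d x 0 i);
  A1 : exists2 c : R, 0 < c &
         forall x, K x -> strongly_convex_on c Od (ft ^~ x);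
  A2 : {within Od `*` Ox, continuous (fun z => ft z.1 z.2)};
  A3 : {within Od `*` Ox, continuous (fun z => grad (ft ^~ z.2) z.1)};
  A4 : forall x, K x -> grad (ft ^~ x) 0 = grad f x;
  A5 : forall x i, K x -> convex_on Od (fun d => gt d x 0 i);
  A6 : forall i, {within setT `*` Ox, continuous (fun z => gt z.1 z.2 0 i)};
  A7 : forall x i, K x -> gt 0 x 0 i = g x 0 i;
  A8 : forall i, {within Od `*` Ox,
         continuous (fun z => grad (fun d => gt d z.2 0 i) z.1)};
  A9 : forall x i, K x ->
         grad (fun d => gt d x 0 i) 0 = grad (fun y => g y 0 i) x }.

Definition assumptionB : Prop :=
  forall S : set 'rV[R]_n, compact S -> S `<=` K ->
    exists mu alpha : R, [/\ 0 < mu, 0 < alpha &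
      forall y z, S y -> S z ->
        enorm (dsol y - dsol z) <= mu * enorm (y - z) `^ alpha].

(* x is the infinite sequence generated from x0: no iterate is stationary. *)
Definition DSM_sequence (gamma : nat -> R) (x0 : 'rV[R]_n)
    (x : nat -> 'rV[R]_n) : Prop :=
  x 0%N = x0 /\
  forall k, ~ stationary K f q g h (x k) /\
            x k.+1 = x k + gamma k *: dsol (x k).

End algorithm.

(* Main.v *)
Require Import Defs.
From HB Require Import structures.
From mathcomp Require Import all_boot all_order all_algebra.
From mathcomp Require Import all_classical all_reals all_analysis.
From mathcomp Require Import ring lra.
Import Order.TTheory GRing.Theory Num.Theory.
Import numFieldNormedType.Exports.
Set Implicit Arguments.
Unset Strict Implicit.
Unset Printing Implicit Defensive.
Local Open Scope classical_set_scope.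
Local Open Scope ring_scope.

(** Convergence rests on the decrease of the ghost penalty
    W(x) = f(x) + q(x) + C phi(x) along the iterates, for a constant C that
    the algorithm never uses.  A step x + t d(x) lowers phi by
    t (phi(x) - kappa(x)), because of the constraints of the subproblem, and
    raises f + q by at most t (the change of the model cost - c/2 |d(x)|^2),
    because the model is strongly convex with the gradient of f at 0; both up
    to O(t^2 |d(x)|^2), the gradients being locally Lipschitz.  So everything
    reduces to bounding the change of the model cost at d(x) by
    C (phi(x) - kappa(x)) ([cost_bounded_by_gap]).  This follows by comparing
    d(x) with one feasible point of the subproblem whose cost is that small,
    so that no multiplier of the subproblems is needed:
    - near an infeasible point where eMFCQ holds, some direction reduces the
      violation by a fixed amount ([violation_decrease]), so that
      phi - kappa stays away from 0 and a bounded cost is enough;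
    - near a feasible point where eMFCQ holds, the linearized constraints can
      be solved with a margin d and with any small right-hand side
      ([eMFCQ_interior]); scaling such a solution by phi / (phi + d) cancels
      the violation at a cost O(phi), and phi - kappa >= lambda phi there.

    Both facts, and the existence of KKT multipliers, come from a single
    theorem of the alternative for a convex system depending on a parameter
    ([parametric_alternative]): the system is solvable with a margin,
    uniformly near the reference parameter, or it has Fritz John multipliers
    at it.  With eMFCQ the second case is impossible, except in the system
    that also asks for a decrease of the cost, where it produces KKT
    multipliers.  Consequently, at a limit point satisfying eMFCQ that is not
    a KKT point, the subproblems nearby would have solutions of uniformly
    lower cost than d = 0, and d(x) could not tend to 0 ([KKT_limit]).

    If the iterates are bounded and every limit point satisfies eMFCQ, the
    local estimates hold with common constants from some index on, and
    W(x_{k+1}) <= W(x_k) - c/4 gamma_k |d(x_k)|^2 with W bounded below.  As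
    the series of gamma diverges, d(x_k) is arbitrarily small infinitely
    often; the corresponding limit point is a KKT point.  This gives the
    first assertion, because a limit point violating eMFCQ is stationary by
    definition.  For the second one, each passage of |d(x_k)| from above e to
    below e/3 would require, by the Hoelder estimate, a displacement of x
    bounded below; such a displacement costs a fixed amount of W, hence
    |d(x_k)| tends to 0 ([steps_vanish]). *)

(** * Vectors, gradients and norms *)

Section vectors.
Context {R : realType}.

Lemma ler_entry_norm k1 k2 (A : 'M[R]_(k1, k2)) i j : `|A i j| <= `|A|.
Proof.
rewrite [leRHS]/Num.norm /= mx_normrE; apply/bigmax_geP; right => /=.
by exists (i, j).
Qed.

Lemma ler_coord_norm n (u : 'rV[R]_n) i : `|u 0 i| <= `|u|.
Proof. exact: ler_entry_norm. Qed.

Lemma norm_le_coord n (u : 'rV[R]_n) r :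
  0 <= r -> (forall i, `|u 0 i| <= r) -> `|u| <= r.
Proof.
move=> r0 ur; rewrite [leLHS]/Num.norm /= mx_normrE.
by apply/bigmax_leP; split => // -[i j] _ /=; rewrite (ord1 i).
Qed.

Lemma dotvDl n (u v w : 'rV[R]_n) : dotv (u + v) w = dotv u w + dotv v w.
Proof.
by rewrite /dotv -big_split /=; apply: eq_bigr => i _; rewrite mxE mulrDl.
Qed.

Lemma dotvZl n a (u w : 'rV[R]_n) : dotv (a *: u) w = a * dotv u w.
Proof.
by rewrite /dotv mulr_sumr; apply: eq_bigr => i _; rewrite mxE mulrA.
Qed.

Lemma dotvC n (u v : 'rV[R]_n) : dotv u v = dotv v u.
Proof. by apply: eq_bigr => i _; rewrite mulrC. Qed.

Lemma dotvZr n a (u w : 'rV[R]_n) : dotv u (a *: w) = a * dotv u w.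
Proof. by rewrite dotvC dotvZl dotvC. Qed.

Lemma dotvNl n (u w : 'rV[R]_n) : dotv (- u) w = - dotv u w.
Proof. by rewrite -scaleN1r dotvZl mulN1r. Qed.

Lemma dotv0r n (u : 'rV[R]_n) : dotv u 0 = 0.
Proof. by rewrite -(scale0r 0) dotvZr mul0r. Qed.

Lemma dotv_le n (u v : 'rV[R]_n) : `|dotv u v| <= n%:R * (`|u| * `|v|).
Proof.
rewrite /dotv (le_trans (ler_norm_sum _ _ _))//.
rewrite (le_trans (ler_sum _ (G := fun=> `|u| * `|v|) _))//.
  by move=> i _; rewrite normrM ler_pM ?ler_coord_norm.
by rewrite sumr_const card_ord mulr_natl.
Qed.

Lemma dotv_mul_tr n m (u : 'rV[R]_m) (A : 'M[R]_(n, m)) (v : 'rV[R]_n) :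
  dotv (u *m A^T) v = dotv u (v *m A).
Proof.
rewrite /dotv; under eq_bigr do rewrite mxE mulr_suml.
rewrite exchange_big /=; apply: eq_bigr => i _.
rewrite mxE mulr_sumr; apply: eq_bigr => j _.
by rewrite mxE -mulrA [A j i * _]mulrC.
Qed.

Lemma norm_le_enorm n (u : 'rV[R]_n) : `|u| <= enorm u.
Proof.
apply: norm_le_coord => [|i]; first exact: sqrtr_ge0.
rewrite -sqrtr_sqr ler_wsqrtr// /dotv (bigD1 i)//= -expr2 lerDl sumr_ge0//.
by move=> j _; rewrite -expr2 sqr_ge0.
Qed.

Lemma enorm_le_norm n (u : 'rV[R]_n) : enorm u <= n%:R * `|u|.
Proof.
have n0 : 0 <= n%:R * `|u| by rewrite mulr_ge0.
rewrite -[leRHS](ger0_norm n0) -sqrtr_sqr ler_wsqrtr//.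
rewrite (le_trans (ler_norm _))// (le_trans (dotv_le _ _))//.
rewrite exprMn -expr2 ler_wpM2r ?sqr_ge0//.
by case: n u {n0} => [|n] u; rewrite ?expr0n// ler_eXnr// ler1n.
Qed.

(** The partial derivatives that make up [grad] determine the directional
    derivatives only where the function is differentiable. *)
Lemma derive_grad n (f : 'rV[R]_n -> R) x v :
  differentiable f x -> 'D_v f x = dotv (grad f x) v.
Proof.
move=> df; rewrite deriveE// {1}(row_sum_delta v) linear_sum /=.
by apply: eq_bigr => i _; rewrite linearZ /= !mxE deriveE// mulrC.
Qed.

Lemma differentiable_fcoord n m (F : 'rV[R]_n -> 'rV[R]_m) x i :
  differentiable F x -> differentiable (fun y => F y 0 i : R) x.
Proof.
move=> dF.
exact: (@differentiable_comp _ _ _ _ F (fun v : 'rV[R]_m => v 0 i) x dF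
  (differentiable_coord _ _ _)).
Qed.

Lemma grad_coord n m (F : 'rV[R]_n -> 'rV[R]_m) x i v :
  differentiable F x -> dotv (grad (fun y => F y 0 i) x) v = (v *m 'J F x) 0 i.
Proof.
move=> dF; rewrite -derive_grad; last exact: differentiable_fcoord.
rewrite deriveE; last exact: differentiable_fcoord.
rewrite -deriveEjacobian// deriveE//.
have @f : {linear 'rV[R]_m -> R}.
  by exists (fun N : 'rV[R]_m => N 0 i); do 2![eexists]; do ?[constructor];
     rewrite ?mxE// => ? *; rewrite ?mxE//; move=> ?; rewrite !mxE.
have cf : continuous f by exact: coord_continuous.
have diff_f (g : {linear 'rV[R]_m -> R}) : continuous g ->
    'd (g \o F) x v = g ('d F x v).
  move=> cg; rewrite diff_comp//; last exact: linear_differentiable.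
  by rewrite [LHS]/= diff_lin.
exact: (diff_f f cf).
Qed.

End vectors.

(** * Limit points and compactness *)

Section sequences.
Context {R : realType} {n : nat}.
Implicit Types (u : nat -> 'rV[R]_n) (l : 'rV[R]_n) (A : set 'rV[R]_n).

(** Limit points without the choice of a subsequence, which is the form that
    is both easy to produce by compactness and easy to exploit. *)
Definition cluster_value u l := forall e, 0 < e -> forall N : nat,
  exists2 k, (N <= k)%N & `|u k - l| < e.

Lemma compact_cluster_value A u :
  compact A -> (forall k, A (u k)) -> exists2 l, A l & cluster_value u l.
Proof.
move=> cA Au; have /cA[l [Al clu]] : (u @ \oo) A by exists 0%N => // k _; exact: Au.
exists l => // e e0 N.
have uN : (u @ \oo) [set u k | k in [set k | (N <= k)%N]].
  by exists N => // k /= Nk; exists k.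
have [_ [[k /= Nk <-]]] := clu _ _ uN (nbhsx_ballx l e e0).
by rewrite -ball_normE /= distrC => ?; exists k.
Qed.

Lemma leq_strict_subseq (s : nat -> nat) :
  {homo s : i j / (i < j)%N} -> forall k, (k <= s k)%N.
Proof.
move=> s_incr; elim => // k ih; exact: leq_ltn_trans ih (s_incr _ _ (ltnSn k)).
Qed.

Lemma subseq_limitP u l : subseq_limit u l <-> cluster_value u l.
Proof.
split.
  case=> s s_incr /cvgrPdist_lt us e e0 N.
  have [M _ sM] := us e e0.
  exists (s (maxn M N)).
    by rewrite (leq_trans (leq_maxr M N))// leq_strict_subseq.
  by rewrite distrC; apply: sM; rewrite /= leq_maxl.
move=> ul.
(* [pick (j, N)] is an index beyond [N] at distance less than 1/(j+1) of [l] *)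
have /choice[pick pickP] (jN : nat * nat) :
    exists k, (jN.2 <= k)%N /\ `|u k - l| < jN.1.+1%:R^-1.
  have [|k Nk ukl] := ul jN.1.+1%:R^-1 _ jN.2; first by rewrite invr_gt0.
  by exists k.
pose s := fix s j := if j is i.+1 then pick (j, (s i).+1) else pick (j, 0)%N.
exists s.
  apply: homo_ltn => [a b c|j]; first exact: ltn_trans.
  by have [] := pickP (j.+1, (s j).+1).
apply/cvgrPdist_lt => e e0.
near=> j.
have sj : `|u (s j) - l| < j.+1%:R^-1.
  by case: (j) => [|i]; [have [] := pickP (0, 0)%N
    | have [] := pickP (i.+1, (s i).+1)].
rewrite distrC (lt_trans sj)//.
near: j; exact: near_infty_natSinv_lt (PosNum e0).
Unshelve. all: by end_near. Qed.

Lemma compact_subseq A u :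
  compact A -> (forall k, A (u k)) -> exists2 l, A l & subseq_limit u l.
Proof.
move=> cA Au; have [l Al ul] := compact_cluster_value cA Au.
by exists l => //; apply/subseq_limitP.
Qed.

Lemma closed_cluster_value A u l :
  closed A -> (forall k, A (u k)) -> cluster_value u l -> A l.
Proof.
move=> cA Au ul; apply: cA => B /nbhs_ballP[e /= e0 eB].
have [k _ ukl] := ul e e0 0%N; exists (u k); split => //.
by apply: eB; rewrite -ball_normE /= distrC.
Qed.

Lemma subseq_cvgn (s : nat -> nat) : {homo s : i j / (i < j)%N} -> s @ \oo --> \oo.
Proof.
move=> s_incr P [N _ NP]; exists N => // k /= Nk; apply: NP => /=.
exact: leq_trans Nk (leq_strict_subseq s_incr k).
Qed.

End sequences.

Lemma cvg_maxr {R : realType} {U : Type} (G : set_system U) {GG : Filter G}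
    (f g : U -> R) a b : f @ G --> a -> g @ G --> b ->
  Num.max (f x) (g x) @[x --> G] --> Num.max a b.
Proof.
move=> fa gb; rewrite maxr_absE; under eq_cvg do rewrite maxr_absE.
apply: cvgM; last exact: cvg_cst.
by apply: cvgD; [exact: cvgD|apply: cvg_norm; exact: cvgB].
Qed.

Section limits.
Context {R : realType} {U : Type} (G : set_system U) {GG : Filter G}.

Lemma cvg_sumr (T : finType) (f : T -> U -> R) (a : T -> R) :
  (forall i, f i @ G --> a i) -> \sum_i f i x @[x --> G] --> \sum_i a i.
Proof. by move=> fa; apply: cvg_big => //; exact: add_continuous. Qed.

Lemma cvg_bigmaxr (T : finType) (f : T -> U -> R) (a : T -> R) :
  (forall i, f i @ G --> a i) ->
  \big[Num.max/0]_i f i x @[x --> G] --> \big[Num.max/0]_i a i.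
Proof.
move=> fa; apply: cvg_big => // -[u v].
by apply: cvg_maxr; [exact: cvg_fst|exact: cvg_snd].
Qed.

End limits.

(** * Convexity and second-order estimates *)

Section convexity.
Context {R : realType} {n : nat}.
Implicit Types (C : set 'rV[R]_n) (f : 'rV[R]_n -> R) (y z : 'rV[R]_n) (t : R).

Lemma convex_setP C : convex_set C <->
  forall t y z, 0 <= t <= 1 -> C y -> C z -> C (t *: y + (1 - t) *: z).
Proof.
split=> [cC t y z t01 Cy Cz|cC y z t /set_mem Cy /set_mem Cz].
  by have := cC y z (Itv01 (andP t01).1 (andP t01).2) (mem_set Cy) (mem_set Cz);
    rewrite inE.
have t01 : 0 <= t%:num <= 1 by apply/andP; split.
by apply/mem_set; exact: cC t01 Cy Cz.
Qed.

Lemma convex_functionP C f : convex_function C f <->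
  forall t y z, 0 <= t <= 1 -> C y -> C z ->
    f (t *: y + (1 - t) *: z) <= t * f y + (1 - t) * f z.
Proof.
split=> [cC t y z t01 Cy Cz|cC t y z /set_mem Cy /set_mem Cz].
  exact: (cC (Itv01 (andP t01).1 (andP t01).2) y z (mem_set Cy) (mem_set Cz)).
have t01 : 0 <= t%:num <= 1 by apply/andP; split.
exact: cC t01 Cy Cz.
Qed.

Lemma convex_setI C D : convex_set C -> convex_set D -> convex_set (C `&` D).
Proof.
move=> /convex_setP cC /convex_setP cD; apply/convex_setP.
by move=> t y z t01 [Cy Dy] [Cz Dz]; split; [exact: cC|exact: cD].
Qed.

Lemma norm_conv_le t y z r :
  0 <= t <= 1 -> `|y| <= r -> `|z| <= r -> `|t *: y + (1 - t) *: z| <= r.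
Proof.
move=> /andP[t0 t1] yr zr; rewrite (le_trans (ler_normD _ _))// !normrZ.
rewrite !ger0_norm ?subr_ge0// (@le_trans _ _ (t * r + (1 - t) * r))//.
  by rewrite lerD// ler_wpM2l ?subr_ge0.
by rewrite -mulrDl addrC subrK mul1r.
Qed.

Lemma convB t y z l :
  t *: y + (1 - t) *: z - l = t *: (y - l) + (1 - t) *: (z - l).
Proof. by apply/rowP => i; rewrite !mxE; ring. Qed.

Definition cball l r : set 'rV[R]_n := [set y | `|y - l| <= r].

Lemma convex_cball l r : convex_set (cball l r).
Proof.
apply/convex_setP => t y z t01 yr zr.
by rewrite /cball /= convB; exact: norm_conv_le.
Qed.

Lemma closed_cball_norm l r : closed (cball l r).
Proof.
have -> : cball l r = (fun y => `|y - l|) @^-1` [set s | s <= r] by [].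
apply: closed_comp => [y _|]; last exact: closed_le.
apply: (@continuous_comp _ _ _ (fun z => z - l) (fun z => `|z|)).
  by apply: continuousB; [exact: cvg_id|exact: cst_continuous].
exact: norm_continuous.
Qed.

Lemma compact_cball l r : compact (cball l r).
Proof.
apply: bounded_closed_compact; last exact: closed_cball_norm.
exists (r + `|l|); split; first exact: num_real.
move=> M rM y yr; apply: (le_trans _ (ltW rM)).
by rewrite -[y](subrK l) (le_trans (ler_normD _ _))// lerD2r.
Qed.

End convexity.

(** By the mean value theorem on the segment, the error of the first-order
    expansion is the variation of the gradient times the displacement, and the
    variation of a Lipschitz gradient is again of the order of the
    displacement. *)
Lemma C1_taylor {R : realType} {n} (U : set 'rV[R]_n) (f : 'rV[R]_n -> R) l :
  open U -> U l -> (forall x, U x -> differentiable f x) ->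
  locally_lipschitz_on U (grad f) ->
  exists C, exists2 r, 0 < r & forall y z, `|y - l| < r -> `|z - l| < r ->
    `|f z - f y - dotv (grad f y) (z - y)| <= C * `|z - y| ^+ 2.
Proof.
move=> oU Ul df /(_ l Ul)[N Nl [M [Mreal lipN]]].
have /nbhs_ballP[r /= r0 rNU] : nbhs l (N `&` U).
  by apply: filterI => //; exact: open_nbhs_nbhs.
pose B := Num.max M 0 + 1.
have B0 : 0 <= B by rewrite addr_ge0// le_max lexx orbT.
have {}lipN : B.-lipschitz_(N `&` U) (grad f).
  by apply: lipN; rewrite /B (@le_lt_trans _ _ (Num.max M 0)) ?ltrDl// le_max lexx.
have inNU (y : 'rV[R]_n) : `|y - l| < r -> (N `&` U) y.
  by move=> yr; apply: rNU; rewrite -ball_normE /= distrC.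
exists (n%:R * B), r => // y z yr zr.
pose c (t : R) : 'rV[R]_n := y + t *: (z - y).
have cr (t : R) : 0 <= t <= 1 -> `|c t - l| < r.
  move=> /andP[t0 t1].
  have -> : c t - l = (1 - t) *: (y - l) + t *: (z - l).
    by apply/rowP => i; rewrite !mxE; ring.
  rewrite (le_lt_trans (ler_normD _ _))// !normrZ !ger0_norm ?subr_ge0//.
  have [->|t_neq0] := eqVneq t 0; first by rewrite mul0r addr0 subr0 mul1r.
  have -> : r = (1 - t) * r + t * r by ring.
  rewrite ler_ltD// ?ler_wpM2l ?subr_ge0 ?(ltW yr)//.
  by rewrite ltr_pM2l// lt0r t_neq0.
pose F (t : R) : R := f (c t).
have dF (t : R) : 0 <= t <= 1 -> is_derive t 1 F (dotv (grad f (c t)) (z - y)).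
  move=> t01; have dfc := df _ (inNU _ (cr t t01)).2.
  have dc : is_derive t 1 c (z - y).
    have -> : z - y = 0 + 1 *: (z - y) by rewrite add0r scale1r.
    have -> : c = cst y + ( *:%R^~ (z - y)) by [].
    apply: is_deriveD.
    split; first by apply/derivable1_diffP; exact: ex_diff.
    by rewrite deriveE ?diff_val//; exact: ex_diff.
  have dcd : differentiable c t by apply/derivable1_diffP.
  have dFd : differentiable F t by exact: differentiable_comp.
  split; first exact/derivable1_diffP.
  rewrite deriveE// [X in X 1 = _](@diff_comp _ _ _ _ c f)//=.
  by rewrite -derive_grad// deriveE// -[in RHS](@derive_val _ _ _ _ _ _ _ dc) deriveE.
have [|t|t|t t01] := @MVT_segment _ F (fun t => dotv (grad f (c t)) (z - y)) 0 1.
- exact: ler01.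
- by rewrite in_itv /= => /andP[/ltW t0 /ltW t1]; apply: dF; rewrite t0.
- apply: continuous_in_subspaceT => s /set_mem /=; rewrite in_itv /= => s01.
  apply: differentiable_continuous; apply/derivable1_diffP.
  exact: (@ex_derive _ _ _ _ _ _ _ (dF s s01)).
have -> : F 1 = f z by rewrite /F /c scale1r addrC subrK.
have -> : F 0 = f y by rewrite /F /c scale0r addr0.
rewrite subr0 mulr1 => ->.
rewrite -dotvNl -dotvDl (le_trans (dotv_le _ _))// -mulrA ler_wpM2l// expr2 mulrA.
rewrite ler_wpM2r//.
have := lipN (c t, y); rewrite /= => /(_ _)/le_trans; apply.
  by split; apply: inNU => //; exact: cr.
rewrite /c [y + _]addrC addrK normrZ.
move: t01; rewrite in_itv /= => /andP[t0 t1].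
rewrite ler_wpM2l// ger0_norm// ler_piMl//.
Qed.

Section coordinates.
Context {R : realType} {n m : nat}.
Implicit Types (U : set 'rV[R]_n) (F : 'rV[R]_n -> 'rV[R]_m).

Lemma sub_entry k1 k2 (A B : 'M[R]_(k1, k2)) i j : (A - B) i j = A i j - B i j.
Proof. by rewrite !mxE. Qed.

Lemma grad_coordE F x i k : differentiable F x ->
  grad (fun y => F y 0 i) x 0 k = 'J F x k i.
Proof.
move=> dF; rewrite mxE derive_grad; last exact: differentiable_fcoord.
by rewrite grad_coord// -rowE mxE.
Qed.

Lemma locally_lipschitz_grad_coord U F i :
  (forall x, U x -> differentiable F x) -> locally_lipschitz_on U (jacobian F) ->
  locally_lipschitz_on U (grad (fun y => F y 0 i)).
Proof.
move=> dF lipJ x Ux; have [N Nx [M [Mreal lipN]]] := lipJ x Ux.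
exists N => //; exists M; split=> // B MB [a b] [[Na Ua] [Nb Ub]] /=.
have := lipN B MB (a, b) (conj (conj Na Ua) (conj Nb Ub)) => /=.
apply: le_trans; apply: norm_le_coord => // k.
rewrite sub_entry (grad_coordE i k (dF a Ua)) (grad_coordE i k (dF b Ub)).
by rewrite -sub_entry ler_entry_norm.
Qed.

End coordinates.

(** Finitely many local estimates, each with its own constant and radius, hold
    with a common constant and a common radius. *)
Lemma uniform_local_bound {R : realType} (T : finType) (P : T -> R -> R -> Prop) :
  (forall i C C' r r', C <= C' -> r' <= r -> P i C r -> P i C' r') ->
  (forall i, exists C, exists2 r, 0 < r & P i C r) ->
  exists2 C, 0 <= C & exists2 r, 0 < r & forall i, P i C r.
Proof.
move=> mono exP.
have /choice[Cr CrP] i : exists Cr : R * R, 0 < Cr.2 /\ P i Cr.1 Cr.2.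
  by have [C [r r0 PCr]] := exP i; exists (C, r).
exists (\sum_i `|(Cr i).1|); first exact: sumr_ge0.
exists (\big[Num.min/1]_i (Cr i).2).
  by apply: lt_bigmin => // i _; have [] := CrP i.
move=> i; have [_] := CrP i; apply: mono; last exact: bigmin_le_cond.
by rewrite (le_trans (ler_norm _))// (bigD1 i)//= lerDl sumr_ge0.
Qed.

(** * Sequences with a sufficient decrease property *)

Section sufficient_decrease.
Context {R : realType} {n : nat}.
Variables (W gamma : nat -> R) (x d : nat -> 'rV[R]_n) (c B : R) (N : nat).
Hypotheses (c0 : 0 < c) (gamma0 : forall k, 0 < gamma k).
Hypothesis gamma_sum : series gamma @ \oo --> +oo.
Hypothesis decrease : forall k, (N <= k)%N ->
  W k.+1 <= W k - c * gamma k * `|d k| ^+ 2.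
Hypothesis W_lower : forall k, (N <= k)%N -> - B <= W k.
Hypothesis x_step : forall k, x k.+1 = x k + gamma k *: d k.

Lemma merit_nonincreasing j k : (N <= k)%N -> (k <= j)%N -> W j <= W k.
Proof.
move=> Nk; elim: j => [|j ih]; first by rewrite leqn0 => /eqP ->.
rewrite leq_eqVlt => /orP[/eqP -> //|]; rewrite ltnS => kj.
apply: le_trans (ih kj); apply: (le_trans (decrease (leq_trans Nk kj))).
by rewrite gerBl mulr_ge0 ?sqr_ge0// mulr_ge0// ltW.
Qed.

(** Steps bounded away from 0 would make [W] decrease at least like the
    divergent series of the step sizes. *)
Lemma arbitrarily_small_steps e (M : nat) : 0 < e ->
  exists2 k, (M <= k)%N & `|d k| < e.
Proof.
move=> e0; apply: contrapT => nosmall.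
have big k : (M <= k)%N -> e <= `|d k|.
  by move=> Mk; rewrite leNgt; apply/negP => dk; apply: nosmall; exists k.
pose L := maxn N M.
have drop k : (L <= k)%N ->
    c * e ^+ 2 * (series gamma k - series gamma L) <= W L - W k.
  elim: k => [|k ih].
    by rewrite leqn0 => /eqP ->; rewrite !subrr mulr0.
  rewrite leq_eqVlt => /orP[/eqP <-|]; first by rewrite !subrr mulr0.
  rewrite ltnS => Lk; have := ih Lk.
  have [Nk Mk] : (N <= k)%N /\ (M <= k)%N.
    by move: Lk; rewrite geq_max => /andP[].
  have := decrease Nk.
  have : c * gamma k * e ^+ 2 <= c * gamma k * `|d k| ^+ 2.
    rewrite ler_wpM2l ?mulr_ge0 ?(ltW c0) ?(ltW (gamma0 _))//.
    by rewrite lerXn2r ?nnegrE ?(ltW e0)// big.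
  rewrite [series gamma k.+1]seriesSr; lra.
have ce : 0 < c * e ^+ 2 by rewrite mulr_gt0// exprn_gt0.
have /cvgryPge/(_ (series gamma L + (W L + B) / (c * e ^+ 2) + 1))[k0 _ Hk] := gamma_sum.
pose k := maxn L k0.
have := Hk k (leq_maxr _ _); have := drop k (leq_maxl _ _).
have Nk : (N <= k)%N by rewrite (leq_trans _ (leq_maxl _ _))// leq_maxl.
have := W_lower Nk => /= low dropk sumk.
have : c * e ^+ 2 * ((W L + B) / (c * e ^+ 2) + 1) <=
    c * e ^+ 2 * (series gamma k - series gamma L).
  by rewrite ler_wpM2l ?(ltW ce)//; lra.
rewrite mulrDr mulr1 [_ * (_ / _)]mulrC divfK ?gt_eqF//; lra.
Qed.

(** A nonincreasing sequence bounded below has small total variation in the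
    long run. *)
Lemma merit_tail eta : 0 < eta -> exists2 M, (N <= M)%N &
  forall j k, (M <= k)%N -> (k <= j)%N -> W k - W j <= eta.
Proof.
move=> eta0; pose A := [set W k | k in [set k | (N <= k)%N]].
have infA : has_inf A.
  split; first by exists (W N), N => //=.
  by exists (- B) => _ [k /= Nk <-]; exact: W_lower.
have [_ [M /= NM <-] WM] := inf_adherent eta0 infA.
exists M => // j k Mk kj.
have Wk : W k <= W M by exact: merit_nonincreasing.
have Wj : inf A <= W j.
  apply: (ge_inf infA.2); exists j => //=.
  by rewrite (leq_trans NM)// (leq_trans Mk).
lra.
Qed.

(** While the directions have norm at least [e], the decrease
    c gamma |d|^2 dominates c e times the displacement gamma |d|. *)
Lemma displacement_le_decrease e j k : (N <= k)%N -> (k <= j)%N ->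
  (forall t, (k <= t < j)%N -> e <= `|d t|) ->
  c * e * `|x j - x k| <= W k - W j.
Proof.
move=> Nk; elim: j => [|j ih].
  by rewrite leqn0 => /eqP -> _; rewrite !subrr normr0 mulr0.
rewrite leq_eqVlt => /orP[/eqP <- _|]; first by rewrite !subrr normr0 mulr0.
rewrite ltnS => kj big.
have {ih}IH : c * e * `|x j - x k| <= W k - W j.
  by apply: ih => // t /andP[kt tj]; apply: big; rewrite kt ltnW.
have [e0|e0] := leP e 0.
  rewrite (@le_trans _ _ 0)//.
    by rewrite mulr_le0_ge0// mulr_ge0_le0// ltW.
  by rewrite subr_ge0 merit_nonincreasing// (leq_trans kj).
have ed : e <= `|d j| by apply: big; rewrite kj leqnn.
have : c * gamma j * (e * `|d j|) <= c * gamma j * `|d j| ^+ 2.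
  by rewrite ler_wpM2l ?mulr_ge0 ?(ltW (gamma0 _)) ?(ltW c0)// expr2 ler_wpM2r.
have := decrease (leq_trans Nk kj).
have : c * e * `|x j.+1 - x k| <= c * e * (`|x j - x k| + gamma j * `|d j|).
  rewrite ler_wpM2l ?mulr_ge0 ?(ltW c0) ?(ltW e0)// x_step addrAC.
  by rewrite (le_trans (ler_normD _ _))// lerD2l normrZ gtr0_norm.
lra.
Qed.

(** The directions are small infinitely often, so one of norm at least [e] is
    followed by one of norm below [e / 3].  Until the first such index the
    displacement is controlled by the decrease of [W], hence is so small that
    the directions at both ends differ by at most [e / 3]. *)
Lemma steps_vanish :
  (forall e, 0 < e -> exists2 r, 0 < r &
     forall j k, `|x j - x k| <= r -> `|d j - d k| <= e) ->
  d @ \oo --> (0 : 'rV[R]_n).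
Proof.
move=> unif; apply/cvgrPdist_lt => e e0.
pose e3 := e / 3; have e30 : 0 < e3 by rewrite divr_gt0.
have [r r0 ur] := unif e3 e30.
have [|M NM tail] := @merit_tail (c * e3 * r); first by rewrite !mulr_gt0.
exists M => // k /= Mk; rewrite sub0r normrN ltNge; apply/negP => ed.
have exj : exists j, (k <= j)%N && (`|d j| < e3).
  by have [j kj dj] := arbitrarily_small_steps k e30; exists j; rewrite kj.
have [j /andP[kj dj] jmin] := ex_minnP exj.
have big t : (k <= t < j)%N -> e3 <= `|d t|.
  move=> /andP[kt tj]; rewrite leNgt; apply/negP => dt.
  by have := jmin t; rewrite kt dt leqNgt tj => /(_ isT).
have := displacement_le_decrease (leq_trans NM Mk) kj big.
move=> /le_trans/(_ (tail j k Mk kj)); rewrite ler_pM2l ?mulr_gt0// => xr.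
have := ur j k xr; have := ler_normB (d j) (d j - d k).
rewrite subKr; rewrite /e3 in dj *; lra.
Qed.

End sufficient_decrease.

(** Turns a Hoelder estimate into a modulus of uniform continuity. *)
Lemma holder_modulus {R : realType} (mu alpha e s : R) :
  0 < mu -> 0 < alpha -> 0 < e -> 0 <= s -> s <= (e / mu) `^ alpha^-1 ->
  mu * s `^ alpha <= e.
Proof.
move=> mu0 a0 e0 s0 se; rewrite -ler_pdivlMl// mulrC.
have -> : e / mu = ((e / mu) `^ alpha^-1) `^ alpha.
  by rewrite -powRrM mulVf ?gt_eqF// powRr1// divr_ge0 ?ltW.
by apply: ge0_ler_powR => //; rewrite ?nnegrE ?powR_ge0// ltW.
Qed.

(** * A theorem of the alternative for convex systems *)

Section fritz_john.
Context {R : realType} {n : nat} {T : finType}.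
Variables (e : pred T) (C : set 'rV[R]_n).
Hypotheses (C0 : C !=set0) (cptC : compact C) (cvxC : convex_set C).

Definition satisfies (u a : T -> R) := forall i, if e i then a i = u i else a i <= u i.

Definition convex_system (F : T -> 'rV[R]_n -> R) :=
  (forall i, {within C, continuous (F i)}) /\
  forall i t y z, 0 <= t <= 1 -> C y -> C z ->
    let Fc := F i (t *: y + (1 - t) *: z) in
    let cF := t * F i y + (1 - t) * F i z in
    if e i then Fc = cF else Fc <= cF.

Let resid (u : T -> R) (a : T -> R) i :=
  if e i then a i - u i else Num.max 0 (a i - u i).

(** The residuals at a point [y0] minimizing the sum of their squares are the
    multipliers, up to normalization: as [y0] is optimal, moving towards any
    [y] cannot decrease the sum to first order.  Since an inequality residual
    is a positive part, the first-order estimate only needs convexity, not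
    differentiability. *)
Lemma infeasible_system_multipliers F u : convex_system F ->
  ~ (exists2 y, C y & satisfies u (F ^~ y)) ->
  exists nu : T -> R, [/\ forall i, `|nu i| <= 1, exists i, `|nu i| = 1,
    forall i, ~~ e i -> 0 <= nu i &
    forall y, C y -> 0 <= \sum_i nu i * (F i y - u i)].
Proof.
move=> [ctF cvxF] unsat.
pose D y := \sum_i resid u (F ^~ y) i ^+ 2.
have ctD : {within C, continuous D}.
  move=> y; apply: cvg_sumr => i; rewrite /resid.
  have cFu : F i z - u i @[z --> y] --> F i y - u i.
    by apply: cvgB; [exact: ctF|exact: cvg_cst].
  rewrite expr2; under eq_cvg do rewrite expr2.
  by case: (e i); apply: cvgM => //; apply: cvg_maxr => //; exact: cvg_cst.
have [y0 /set_mem Cy0 minD] := EVT_min_rV C0 cptC ctD.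
pose r i := resid u (F ^~ y0) i.
have [i0 ri0] : exists i, r i != 0.
  apply: contrapT => /forallNP r0; apply: unsat; exists y0 => // i.
  have /negP := r0 i; rewrite negbK /r /resid.
  case: (e i) => [/eqP/subr0_eq //|/eqP rE].
  by rewrite -subr_le0 -rE le_max lexx orbT.
have rsum y : C y -> 0 <= \sum_i r i * (F i y - u i).
  move=> Cy; pose b i := F i y - u i.
  (* optimality of [y0] against the point at parameter [t] on the segment *)
  have step t : 0 < t -> t <= 1 ->
      0 <= 2 * (\sum_i r i * (b i - r i)) + t * \sum_i (b i - r i) ^+ 2.
    move=> t0 t1; have t01 : 0 <= t <= 1 by rewrite ltW.
    have Cc : C (t *: y + (1 - t) *: y0) by move/convex_setP: cvxC; exact.
    have := minD _ (mem_set Cc).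
    have H : D (t *: y + (1 - t) *: y0) <=
        \sum_i ((1 - t) * r i + t * b i) ^+ 2.
      apply: ler_sum => i _; have := cvxF i t y y0 t01 Cy Cy0.
      rewrite /resid /r /resid /b; case: (e i) => /= [->|Fle].
        by rewrite le_eqVlt; apply/orP; left; apply/eqP; ring.
      set a := F i y0 - u i; set s := _ - u i; set c := F i y - u i.
      have a_le : a <= Num.max 0 a by rewrite le_max lexx orbT.
      have s_le : s <= (1 - t) * Num.max 0 a + t * c.
        rewrite (@le_trans _ _ ((1 - t) * a + t * c))//.
          by rewrite /s /a /c; lra.
        by rewrite lerD2r ler_wpM2l// subr_ge0.
      case: (leP 0 s) => s0; last by rewrite expr0n /= sqr_ge0.
      by rewrite lerXn2r// nnegrE (le_trans s0).
    move=> /le_trans/(_ H); have -> : \sum_i ((1 - t) * r i + t * b i) ^+ 2 = D y0 +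
        t * (2 * (\sum_i r i * (b i - r i)) + t * \sum_i (b i - r i) ^+ 2).
      rewrite /D !mulr_sumr -big_split /= mulr_sumr -big_split /=.
      by apply: eq_bigr => i _; rewrite -/(r i); ring.
    by rewrite lerDl pmulr_rge0.
  have : 0 <= \sum_i r i * (b i - r i).
    rewrite leNgt; apply/negP; set S := \sum_i _ => S0.
    pose Q := \sum_i (b i - r i) ^+ 2.
    have Q0 : 0 <= Q by apply: sumr_ge0 => i _; exact: sqr_ge0.
    (* small enough for the linear term 2 S to dominate t Q *)
    pose t := Num.min 1 (- S / (Q + 1)).
    have t0 : 0 < t by rewrite lt_min ltr01 divr_gt0 ?oppr_gt0// ltr_wpDl.
    have tQ : t * Q <= - S.
      rewrite (@le_trans _ _ ((- S / (Q + 1)) * Q))//.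
        by rewrite ler_wpM2r// ge_min lexx orbT.
      rewrite mulrAC ler_pdivrMr ?ltr_wpDl// ler_wpM2l ?oppr_ge0 ?ltW//.
      by rewrite ltrDl.
    have := step t t0; rewrite ge_min lexx /= => /(_ isT).
    by rewrite -/S -/Q; apply/negP; rewrite -ltNge; lra.
  move=> /le_trans; apply; apply: ler_sum => i _.
  by rewrite mulrBr lerBlDr lerDl -expr2 sqr_ge0.
case: (@Order.TotalTheory.arg_maxP _ _ T i0 xpredT (fun i => `|r i|) isT) => i1 _ max1.
have r1 : 0 < `|r i1| by rewrite (lt_le_trans _ (max1 i0 isT))// normr_gt0.
exists (fun i => r i / `|r i1|); split.
- by move=> i; rewrite normrM normfV normr_id ler_pdivrMr// mul1r; exact: max1.
- by exists i1; rewrite normrM normfV normr_id divff// gt_eqF.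
- move=> i ei; rewrite divr_ge0// /r /resid (negbTE ei).
  by rewrite le_max lexx.
- move=> y Cy; under eq_bigr do rewrite mulrAC.
  by rewrite -mulr_suml divr_ge0// rsum.
Qed.

(** If no margin works uniformly near [l], there are parameters tending to [l]
    and right-hand sides tending to 0 for which the system has no solution.
    Each such system has multipliers of norm 1, and by compactness a
    subsequence of them has a nonzero limit; passing to the limit at each fixed
    [y] only uses the continuity of the system in the parameter. *)
Lemma parametric_alternative (X : set 'rV[R]_n)
    (F : T -> 'rV[R]_n -> 'rV[R]_n -> R) (l : 'rV[R]_n) :
  (forall x, X x -> convex_system (fun i y => F i y x)) ->
  (forall i y, C y -> {for l, continuous (F i y)}) ->
  (exists2 d : R, 0 < d & forall (x : 'rV[R]_n) (v : T -> R), X x -> `|x - l| < d ->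
     (forall i, if e i then (`|v i| <= d : Prop) else v i = - d) ->
     exists2 y, C y & satisfies v (fun i => F i y x)) \/
  (exists nu : T -> R, [/\ exists i, nu i != 0, forall i, ~~ e i -> 0 <= nu i &
     forall y, C y -> 0 <= \sum_i nu i * F i y l]).
Proof.
move=> cvxF ctF.
apply/or_asboolP; rewrite -implyNb; apply/implyP => /asboolPn nosol.
apply/asboolP.
(* [z] is a triple (parameter, right-hand side, multipliers) *)
have step (k : nat) : exists z : 'rV[R]_n * (T -> R) * (T -> R),
    [/\ `|z.1.1 - l| < k.+1%:R^-1, forall i, `|z.1.2 i| <= k.+1%:R^-1,
     forall i, `|z.2 i| <= 1, exists i, `|z.2 i| = 1 &
     (forall i, ~~ e i -> 0 <= z.2 i) /\
     forall y, C y -> 0 <= \sum_i z.2 i * (F i y z.1.1 - z.1.2 i)].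
  have k0 : 0 < k.+1%:R^-1 :> R by rewrite invr_gt0.
  apply: contrapT => /forallNP nostep; apply: nosol; exists k.+1%:R^-1 => //.
  move=> x v Xx xl vk; apply: contrapT => unsat.
  have [nu [nu1 nu1E nu0 nusum]] := infeasible_system_multipliers (cvxF x Xx) unsat.
  apply: (nostep (x, v, nu)); split => //= i; have := vk i.
  by case: (e i) => // ->; rewrite normrN gtr0_norm.
have [z zP] := choice step.
pose w k : 'rV[R]_#|T| := \row_j (z k).2 (enum_val j).
have w1 k : `|w k| = 1.
  have [_ _ z1 [i zi] _] := zP k; apply/eqP; rewrite eq_le; apply/andP; split.
    by apply: norm_le_coord => // j; rewrite mxE.
  rewrite -zi (_ : (z k).2 i = w k 0 (enum_rank i)) ?ler_coord_norm//.
  by rewrite mxE enum_rankK.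
have [|w0 _ [s s_incr ws]] := @compact_subseq _ _ _ w (@compact_cball R #|T| 0 1).
  by move=> k; rewrite /cball /= subr0 w1.
pose nu i := w0 0 (enum_rank i).
have nu_cvg i : (z (s k)).2 i @[k --> \oo] --> nu i.
  have -> : (fun k => (z (s k)).2 i) = (fun k => (w \o s) k 0 (enum_rank i)).
    by apply/funext => k; rewrite /= mxE enum_rankK.
  exact: (cvg_comp _ _ ws (@coord_continuous _ _ _ _ _ _)).
have inv_cvg : (s k).+1%:R^-1 @[k --> \oo] --> (0 : R).
  exact: cvg_comp (subseq_cvgn s_incr) (@cvg_harmonic R).
have /cvgrPdist_lt inv0 := inv_cvg.
have zl : (z (s k)).1.1 @[k --> \oo] --> l.
  apply/cvgrPdist_lt => eps eps0; have [M _ HM] := inv0 eps eps0.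
  exists M => // k /HM /=; rewrite sub0r normrN gtr0_norm ?invr_gt0//.
  by have [+ _ _ _ _] := zP (s k); rewrite distrC; exact: lt_trans.
have zv i : (z (s k)).1.2 i @[k --> \oo] --> (0 : R).
  apply/cvgrPdist_lt => eps eps0; have [M _ HM] := inv0 eps eps0.
  exists M => // k /HM /=; rewrite !sub0r !normrN gtr0_norm ?invr_gt0//.
  by have [_ /(_ i) + _ _ _] := zP (s k); exact: le_lt_trans.
exists nu; split.
- apply: contrapT => /forallNP nu0.
  have w00 : w0 = 0.
    apply/rowP => j; rewrite mxE; have /negP := nu0 (enum_val j).
    by rewrite negbK /nu enum_valK => /eqP.
  have : `|w (s k)| @[k --> \oo] --> `|w0| by exact: cvg_norm.
  under eq_fun do rewrite w1.
  move=> /(cvg_unique (@norm_hausdorff _ R^o) (cvg_cst (1 : R))).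
  by rewrite w00 normr0 => /eqP; rewrite oner_eq0.
- move=> i ei; apply: cvgr_to_ge (nu_cvg i) _ => //.
  by apply: nearW => k; have [_ _ _ _ [+ _]] := zP (s k); exact.
- move=> y Cy.
  have : \sum_i (z (s k)).2 i * (F i y (z (s k)).1.1 - (z (s k)).1.2 i)
      @[k --> \oo] --> \sum_i nu i * (F i y l - 0).
    apply: cvg_sumr => i; apply: cvgM; first exact: nu_cvg.
    apply: cvgB; last exact: zv.
    exact: (cvg_comp _ _ zl (ctF i y Cy)).
  under [X in _ --> X]eq_bigr do rewrite subr0.
  move=> sum_cvg; apply: (cvgr_to_ge sum_cvg).
  by apply: nearW => k; have [_ _ _ _ [_ +]] := zP (s k); exact.
Qed.

End fritz_john.

(** * The subproblem *)

Section max_violation.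
Context {R : realType} {m p : nat}.
Implicit Types (u : 'rV[R]_m) (v : 'rV[R]_p).

Lemma max_violation_le u v r : max_violation u v <= r <->
  [/\ 0 <= r, forall i, u 0 i <= r & forall j, `|v 0 j| <= r].
Proof.
rewrite /max_violation ge_max; split.
  move=> /andP[/bigmax_leP[r0 ur] /bigmax_leP[_ vr]]; split => // [i|j].
    by have := ur i isT; rewrite ge_max => /andP[].
  exact: vr.
move=> [r0 ur vr]; apply/andP; split; apply/bigmax_leP; split => // i _.
by rewrite ge_max r0 ur.
Qed.

Lemma max_violation_ge0 u v : 0 <= max_violation u v.
Proof. by have [] := (max_violation_le u v (max_violation u v)).1 (lexx _). Qed.

Lemma le_max_violation_l u v i : u 0 i <= max_violation u v.
Proof. by have [] := (max_violation_le u v (max_violation u v)).1 (lexx _). Qed.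

Lemma le_max_violation_r u v j : `|v 0 j| <= max_violation u v.
Proof. by have [] := (max_violation_le u v (max_violation u v)).1 (lexx _). Qed.

Lemma max_violation_cvg {T : Type} (G : set_system T) {GG : Filter G}
    (a : T -> 'rV[R]_m) (b : T -> 'rV[R]_p) u v :
  (forall i, a t 0 i @[t --> G] --> u 0 i) ->
  (forall j, b t 0 j @[t --> G] --> v 0 j) ->
  max_violation (a t) (b t) @[t --> G] --> max_violation u v.
Proof.
move=> au bv; apply: cvg_maxr; apply: cvg_bigmaxr => i.
  by apply: cvg_maxr => //; exact: cvg_cst.
by apply: cvg_norm; exact: bv.
Qed.

End max_violation.

Section set_min.
Context {R : realType}.

Lemma set_minP (A : set R) a : is_min A a -> is_min A (set_min A).
Proof. by move=> Aa; apply: getPex; exists a. Qed.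

End set_min.

Section open_continuity.
Context {R : realType}.

Lemma within_open_continuous (T V : topologicalType) (A : set T) (F : T -> V) a :
  open A -> {within A, continuous F} -> A a -> {for a, continuous F}.
Proof. by move=> oA; rewrite continuous_open_subspace// => + Aa; apply; exact: mem_set. Qed.

Lemma open_setX (T V : topologicalType) (A : set T) (B : set V) :
  open A -> open B -> open (A `*` B).
Proof.
move=> oA oB; have -> : A `*` B = fst @^-1` A `&` snd @^-1` B by [].
by apply: openI; apply: open_comp => // -[a b] _; [exact: cvg_fst|exact: cvg_snd].
Qed.

Lemma locally_lipschitz_continuous (V W : normedModType R) (U : set V) (F : V -> W) x :
  open U -> locally_lipschitz_on U F -> U x -> {for x, continuous F}.
Proof.
move=> oU lipF Ux; have [N Nx [M [_ lipN]]] := lipF x Ux.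
pose B := Num.max M 0 + 1.
have B0 : 0 < B by rewrite ltr_wpDl// le_max lexx orbT.
have {}lipN : B.-lipschitz_(N `&` U) F.
  by apply: lipN; rewrite /B (@le_lt_trans _ _ (Num.max M 0)) ?ltrDl// le_max lexx.
apply/cvgrPdist_lt => e e0; near=> y.
have Ny : (N `&` U) y.
  by near: y; apply: filterI => //; exact: open_nbhs_nbhs.
have := lipN (x, y) (conj (conj (nbhs_singleton Nx) Ux) Ny) => /= /le_lt_trans; apply.
rewrite -ltr_pdivlMl//; near: y.
by apply: cvgr_dist_lt => //; rewrite mulr_gt0// invr_gt0.
Unshelve. all: by end_near. Qed.

End open_continuity.

Section subproblem.
Context {R : realType} {n m p : nat}.
Variables (K : set 'rV[R]_n) (f q : 'rV[R]_n -> R).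
Variables (g : 'rV[R]_n -> 'rV[R]_m) (h : 'rV[R]_n -> 'rV[R]_p).
Variables (ft : 'rV[R]_n -> 'rV[R]_n -> R).
Variables (gt : 'rV[R]_n -> 'rV[R]_n -> 'rV[R]_m).
Variables (beta rho lambda : R) (Od Ox : set 'rV[R]_n).
Hypotheses (clK : closed K) (cvxK : convex_set K).
Hypothesis fC11 : exists U, [/\ open U, K `<=` U & C11_on U f].
Hypothesis gC11 : exists U, [/\ open U, K `<=` U & C11_map_on U g].
Hypothesis hC11 : exists U, [/\ open U, K `<=` U & C11_map_on U h].
Hypothesis cvxq : convex_function K q.
Hypothesis qlip :
  exists U, [/\ open U, K `<=` U & locally_lipschitz_on U (q : _ -> R^o)].
Hypotheses (beta0 : 0 < beta) (rhob : 0 < rho < beta) (lam01 : 0 < lambda < 1).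
Hypothesis AA : assumptionA K f g ft gt beta Od Ox.

Implicit Types d x y z : 'rV[R]_n.

Lemma convexK t y z : 0 <= t <= 1 -> K y -> K z -> K (t *: y + (1 - t) *: z).
Proof. by move/convex_setP: cvxK; exact. Qed.

Lemma q_continuous x : K x -> {for x, continuous q}.
Proof.
move=> Kx; have [U [oU KU lipq]] := qlip.
exact: (locally_lipschitz_continuous oU lipq (KU x Kx)).
Qed.

Lemma g_differentiable x : K x -> differentiable g x.
Proof. by move=> Kx; have [U [oU KU [dg _ _]]] := gC11; exact/dg/KU. Qed.

Lemma h_differentiable x : K x -> differentiable h x.
Proof. by move=> Kx; have [U [oU KU [dh _ _]]] := hC11; exact/dh/KU. Qed.

Lemma Jh_continuous x : K x -> {for x, continuous (jacobian h)}.
Proof.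
move=> Kx; have [U [oU KU [_ + _]]] := hC11.
by move=> /within_open_continuous; apply => //; exact: KU.
Qed.

Lemma beta_ball_Od d : `|d| <= beta -> Od d.
Proof. exact: (A_Od_ball AA). Qed.

Lemma rho_le_beta : rho <= beta.
Proof. by have /andP[_ /ltW] := rhob. Qed.

Lemma htE d x j : ht h d x 0 j = h x 0 j + \sum_i d 0 i * 'J h x i j.
Proof. by rewrite /ht !mxE. Qed.

Section limits.
Context {T : Type} (G : set_system T) {GG : Filter G}.
Variables (u v : T -> 'rV[R]_n).

Lemma ft_cvg d x : `|d| <= beta -> K x -> u @ G --> d -> v @ G --> x ->
  ft (u t) (v t) @[t --> G] --> ft d x.
Proof.
move=> db Kx ud vx; apply: (@continuous2_cvg _ _ _ _ G _ u v ft d x _ ud vx).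
apply: (@within_open_continuous _ _ _ _ (d, x) _ (A2 AA)).
  by apply: open_setX; [exact: (A_Od_open AA)|exact: (A_Ox_open AA)].
by split => /=; [exact: beta_ball_Od|exact: (A_Ox_K AA)].
Qed.

Lemma gt_cvg d x i : K x -> u @ G --> d -> v @ G --> x ->
  gt (u t) (v t) 0 i @[t --> G] --> gt d x 0 i.
Proof.
move=> Kx ud vx; apply: (@continuous2_cvg _ _ _ _ G _ u v (fun d x => gt d x 0 i) d x _ ud vx).
apply: (@within_open_continuous _ _ _ _ (d, x) _ (@A6 _ _ _ _ _ _ _ _ _ _ _ AA i)).
  by apply: open_setX; [exact: openT|exact: (A_Ox_open AA)].
by split => //=; exact: (A_Ox_K AA).
Qed.

Lemma coord_cvg k (w : T -> 'rV[R]_k) (a : 'rV[R]_k) j :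
  w @ G --> a -> w t 0 j @[t --> G] --> a 0 j.
Proof. by move=> wa; exact: (cvg_comp _ _ wa (@coord_continuous _ _ _ _ _ _)). Qed.

Lemma g_cvg x i : K x -> v @ G --> x -> g (v t) 0 i @[t --> G] --> g x 0 i.
Proof.
move=> Kx vx; apply: coord_cvg.
exact: (cvg_comp _ _ vx (differentiable_continuous (g_differentiable Kx))).
Qed.

Lemma h_cvg x j : K x -> v @ G --> x -> h (v t) 0 j @[t --> G] --> h x 0 j.
Proof.
move=> Kx vx; apply: coord_cvg.
exact: (cvg_comp _ _ vx (differentiable_continuous (h_differentiable Kx))).
Qed.

Lemma ht_cvg d x j : K x -> u @ G --> d -> v @ G --> x ->
  ht h (u t) (v t) 0 j @[t --> G] --> ht h d x 0 j.
Proof.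
move=> Kx ud vx.
(* replaces the coordinate of [ht] by its explicit form in both occurrences *)
suff key (F : 'rV[R]_n -> 'rV[R]_n -> R) :
    F = (fun d x => h x 0 j + \sum_i d 0 i * 'J h x i j) ->
    F (u t) (v t) @[t --> G] --> F d x.
  apply: (key (fun d x => ht h d x 0 j)).
  by apply/funext => d'; apply/funext => x'; exact: htE.
move=> ->; apply: cvgD; first exact: h_cvg.
apply: cvg_sumr => i; apply: cvgM; first exact: coord_cvg.
have Jx := cvg_comp _ _ vx (Jh_continuous Kx).
exact: (cvg_comp _ _ Jx (@coord_continuous _ _ _ _ _ _)).
Qed.

Lemma q_cvg x : K x -> v @ G --> x -> q (v t) @[t --> G] --> q x.
Proof. by move=> Kx vx; exact: cvg_comp vx (q_continuous Kx). Qed.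

End limits.

Definition viol d x := max_violation (gt d x) (ht h d x).

Local Notation phi := (phi g h).
Local Notation kappa := (kappa K g h gt rho lambda).
Local Notation dsol := (dsol K q g h ft gt beta rho lambda).

Lemma viol_cvg {T : Type} (G : set_system T) {GG : Filter G} (u v : T -> 'rV[R]_n) d x :
  K x -> u @ G --> d -> v @ G --> x -> viol (u t) (v t) @[t --> G] --> viol d x.
Proof.
move=> Kx ud vx.
by apply: max_violation_cvg => i; [exact: gt_cvg|exact: ht_cvg].
Qed.

Lemma viol_continuous x : K x -> continuous (viol ^~ x).
Proof.
move=> Kx d; apply: (@viol_cvg _ (nbhs d) _ id (fun=> x) d x Kx).
  exact: cvg_id.
exact: cvg_cst.
Qed.

Lemma ft_continuous d x : `|d| <= beta -> K x -> {for d, continuous (ft ^~ x)}.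
Proof.
move=> db Kx.
apply: (@ft_cvg _ (nbhs d) _ id (fun=> x) d x db Kx); first exact: cvg_id.
exact: cvg_cst.
Qed.

Lemma phi_cvg {T : Type} (G : set_system T) {GG : Filter G} (v : T -> 'rV[R]_n) x :
  K x -> v @ G --> x -> phi (v t) @[t --> G] --> phi x.
Proof.
by move=> Kx vx; apply: max_violation_cvg => i; [exact: g_cvg|exact: h_cvg].
Qed.

Lemma phi_continuous x : K x -> {for x, continuous phi}.
Proof. by move=> Kx; apply: (@phi_cvg _ (nbhs x) _ id x Kx); exact: cvg_id. Qed.

Lemma ht_at0 x : ht h 0 x = h x.
Proof. by rewrite /ht mul0mx addr0. Qed.

Lemma gt_at0 x : K x -> gt 0 x = g x.
Proof. by move=> Kx; apply/rowP => i; exact: (A7 AA). Qed.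

Lemma viol_at0 x : K x -> viol 0 x = phi x.
Proof. by move=> Kx; rewrite /viol ht_at0 gt_at0. Qed.

Lemma ht_conv t d d' x :
  ht h (t *: d + (1 - t) *: d') x = t *: ht h d x + (1 - t) *: ht h d' x.
Proof.
rewrite /ht mulmxDl -!scalemxAl; apply/rowP => j; rewrite !mxE; ring.
Qed.

Lemma conv_coord k t (a b : 'rV[R]_k) j :
  (t *: a + (1 - t) *: b) 0 j = t * a 0 j + (1 - t) * b 0 j.
Proof. by rewrite !mxE. Qed.

Lemma gt_convex t d d' x i : K x -> 0 <= t <= 1 -> `|d| <= beta -> `|d'| <= beta ->
  gt (t *: d + (1 - t) *: d') x 0 i <= t * gt d x 0 i + (1 - t) * gt d' x 0 i.
Proof.
move=> Kx t01 db d'b.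
have ballOd : cball 0 beta `<=` Od.
  by move=> z; rewrite /cball /= subr0; exact: beta_ball_Od.
have /convex_functionP := A5 AA i Kx ballOd (@convex_cball _ _ _ _).
by apply => //; rewrite /cball /= subr0.
Qed.

(** The strong convexity of the model on the box of radius [beta], with a
    modulus that does not depend on the base point. *)
Definition strongly_convex_model c :=
  forall t d d' x, K x -> 0 <= t <= 1 -> `|d| <= beta -> `|d'| <= beta ->
  ft (t *: d + (1 - t) *: d') x <= t * ft d x + (1 - t) * ft d' x
    - c / 2 * t * (1 - t) * enorm (d - d') ^+ 2.

Lemma ft_strongly_convex : exists2 c, 0 < c & strongly_convex_model c.
Proof.
have [c c0 cvxc] := A1 AA; exists c => // t d d' x Kx t01 db d'b.
have ballOd : cball 0 beta `<=` Od.
  by move=> z; rewrite /cball /= subr0; exact: beta_ball_Od.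
have := cvxc x Kx _ ballOd (@convex_cball _ _ _ _) t t01 d d'.
by rewrite /cball /= !subr0; exact.
Qed.

Lemma ft_convex t d d' x : K x -> 0 <= t <= 1 -> `|d| <= beta -> `|d'| <= beta ->
  ft (t *: d + (1 - t) *: d') x <= t * ft d x + (1 - t) * ft d' x.
Proof.
move=> Kx t01 db d'b; have [c c0 cvxc] := ft_strongly_convex.
apply: (le_trans (cvxc _ _ _ _ Kx t01 db d'b)).
have /andP[t0 t1] := t01.
have c2 : 0 <= c / 2 by rewrite divr_ge0// ltW.
by rewrite gerBl mulr_ge0 ?sqr_ge0// mulr_ge0 ?subr_ge0// mulr_ge0.
Qed.

Lemma q_convex t y z : 0 <= t <= 1 -> K y -> K z ->
  q (t *: y + (1 - t) *: z) <= t * q y + (1 - t) * q z.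
Proof. by move/convex_functionP: cvxq; exact. Qed.

Lemma viol_convex t d d' x : K x -> 0 <= t <= 1 -> `|d| <= beta -> `|d'| <= beta ->
  viol (t *: d + (1 - t) *: d') x <= t * viol d x + (1 - t) * viol d' x.
Proof.
move=> Kx t01 db d'b; have /andP[t0 t1] := t01.
have t1' : 0 <= 1 - t by rewrite subr_ge0.
apply/max_violation_le; split => [|i|j].
- by rewrite addr_ge0// mulr_ge0// max_violation_ge0.
- apply: (le_trans (gt_convex _ Kx t01 db d'b)).
  by rewrite lerD// ler_wpM2l//; exact: le_max_violation_l.
- rewrite ht_conv conv_coord (le_trans (ler_normD _ _))// !normrM (ger0_norm t0) (ger0_norm t1').
  by rewrite lerD// ler_wpM2l//; exact: le_max_violation_r.
Qed.

Let trust x r := [set d | `|d| <= r /\ K (x + d)].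

Lemma trust_compact x r : compact (trust x r).
Proof.
have -> : trust x r = cball 0 r `&` ((fun d => x + d) @^-1` K).
  by apply/seteqP; split => d; rewrite /trust /cball /= subr0.
apply: compact_closedI; first exact: compact_cball.
apply: closed_comp clK => d _.
by apply: continuousD; [exact: cst_continuous|exact: cvg_id].
Qed.

Definition least_viol x := set_min [set viol d x | d in trust x rho].

Lemma least_violP x : K x ->
  exists d, [/\ `|d| <= rho, K (x + d), viol d x = least_viol x &
    forall d', `|d'| <= rho -> K (x + d') -> least_viol x <= viol d' x].
Proof.
move=> Kx; have rho_ge0 : 0 <= rho by have /andP[/ltW] := rhob.
have [||d /set_mem[dr Kd] dmin] :=
    @EVT_min_rV R n (viol ^~ x) (trust x rho) _ (@trust_compact x rho) _.
- by exists 0; split; rewrite ?normr0 ?addr0.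
- by apply: continuous_subspaceT; exact: viol_continuous.
have [|[d1 [d1r Kd1] d1E] lb] := @set_minP _ [set viol d x | d in trust x rho] (viol d x).
  split; first by exists d.
  by move=> _ [d' d'x <-]; apply: dmin; exact: mem_set.
exists d1; split => // d' d'r Kd'; apply: lb; by exists d'.
Qed.

Lemma kappaE x : kappa x = (1 - lambda) * phi x + lambda * least_viol x.
Proof. by []. Qed.

Lemma least_viol_ge0 x : K x -> 0 <= least_viol x.
Proof. by move=> /least_violP[d [_ _ <- _]]; exact: max_violation_ge0. Qed.

Lemma least_viol_le_phi x : K x -> least_viol x <= phi x.
Proof.
move=> Kx; have [d [_ _ _ H]] := least_violP Kx.
rewrite -viol_at0//; apply: H; rewrite ?normr0 ?addr0//.
by have /andP[/ltW] := rhob.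
Qed.

Lemma kappa_ge x : K x -> (1 - lambda) * phi x <= kappa x.
Proof.
move=> Kx; rewrite kappaE lerDl mulr_ge0 ?least_viol_ge0//.
by have /andP[/ltW] := lam01.
Qed.

Lemma kappa_ge0 x : K x -> 0 <= kappa x.
Proof.
move=> Kx; apply: le_trans (kappa_ge Kx).
by rewrite mulr_ge0 ?max_violation_ge0// subr_ge0; have /andP[_ /ltW] := lam01.
Qed.

(** The decrease of the violation guaranteed by the subproblem is a fixed
    fraction of the one that is possible within radius [rho]. *)
Lemma kappa_gap x : phi x - kappa x = lambda * (phi x - least_viol x).
Proof. by rewrite kappaE; ring. Qed.

Lemma kappa_le_phi x : K x -> kappa x <= phi x.
Proof.
move=> Kx; rewrite -subr_ge0 kappa_gap mulr_ge0 ?subr_ge0 ?least_viol_le_phi//.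
by have /andP[/ltW] := lam01.
Qed.

Lemma sub_feasibleP x d : K x ->
  sub_feasible K g h gt beta rho lambda x d <->
  [/\ viol d x <= kappa x, `|d| <= beta & K (x + d)].
Proof.
move=> Kx; split.
  move=> [gd hd db Kd]; split => //; apply/max_violation_le; split => //.
    exact: kappa_ge0.
  by move=> j; rewrite ler_norml hd.
move=> [/max_violation_le[_ gd hd] db Kd]; split => // j.
by rewrite -ler_norml.
Qed.

(** The violation is convex along the segment from 0 to a point [d] of least
    violation, and at its point of parameter [lambda] this convexity bound is
    exactly [kappa]: the subproblem is never empty. *)
Lemma scaled_least_viol_feasible x d : K x -> `|d| <= rho -> K (x + d) ->
  viol d x = least_viol x -> sub_feasible K g h gt beta rho lambda x (lambda *: d).
Proof.
move=> Kx dr Kd dE; have lam01' : 0 <= lambda <= 1 by have /andP[/ltW-> /ltW->] := lam01.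
have -> : lambda *: d = lambda *: d + (1 - lambda) *: 0 by rewrite scaler0 addr0.
have db : `|d| <= beta by rewrite (le_trans dr)// rho_le_beta.
have b0 : `|0 : 'rV[R]_n| <= beta by rewrite normr0 ltW.
apply/sub_feasibleP => //; split.
- apply: (le_trans (viol_convex Kx lam01' db b0)).
  by rewrite kappaE (viol_at0 Kx) dE addrC.
- exact: norm_conv_le.
- have := convexK lam01' Kd Kx.
  suff -> : lambda *: (x + d) + (1 - lambda) *: x =
    x + (lambda *: d + (1 - lambda) *: 0) by [].
  by apply/rowP => i; rewrite !mxE; ring.
Qed.

(** The feasible set is compact and nonempty and the objective is
    continuous. *)
Lemma dsolP x : K x -> sub_solution K q g h ft gt beta rho lambda x (dsol x).
Proof.
move=> Kx; apply: getPex.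
have [d0 [d0r Kd0 d0E _]] := least_violP Kx.
have d0f := scaled_least_viol_feasible Kx d0r Kd0 d0E.
pose A := trust x beta `&` [set d | viol d x <= kappa x].
have AE d : A d <-> sub_feasible K g h gt beta rho lambda x d.
  by rewrite sub_feasibleP// /A /trust /=; split; [case=> -[]|case].
have cptA : compact A.
  apply: compact_closedI; first exact: trust_compact.
  have -> : [set d | viol d x <= kappa x] = (viol ^~ x) @^-1` [set s | s <= kappa x] by [].
  apply: closed_comp; last exact: closed_le.
  by move=> d _; exact: viol_continuous.
have [||d /set_mem/AE df dmin] :=
    @EVT_min_rV R n (fun d => ft d x + q (x + d)) A _ cptA _.
- by exists (lambda *: d0); exact/AE.
- apply: continuous_in_subspaceT => d /set_mem[[db Kd] _].
  apply: continuousD; first exact: ft_continuous.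
  apply: continuous_comp; last exact: q_continuous.
  by apply: continuousD; [exact: cst_continuous|exact: cvg_id].
by exists d; split => // d' /AE/mem_set; exact: dmin.
Qed.

Lemma dsol_feasible x : K x ->
  [/\ viol (dsol x) x <= kappa x, `|dsol x| <= beta & K (x + dsol x)].
Proof. by move=> Kx; apply/sub_feasibleP => //; exact: (dsolP Kx).1. Qed.

Lemma dsol_optimal x d : K x -> viol d x <= kappa x -> `|d| <= beta -> K (x + d) ->
  ft (dsol x) x + q (x + dsol x) <= ft d x + q (x + d).
Proof. by move=> Kx dk db Kd; apply: (dsolP Kx).2; exact/sub_feasibleP. Qed.

(** * Multipliers at a reference point *)

Lemma right_difference_quotient (F : 'rV[R]_n -> R) (w : 'rV[R]_n) : differentiable F 0 ->
  t^-1 * (F (t *: w) - F 0) @[t --> 0^'+] --> dotv (grad F 0) w.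
Proof.
move=> dF; apply: cvg_dnbhs_at_right; rewrite -derive_grad//.
have : derivable F 0 w by exact: diff_derivable.
rewrite /derivable /derive.
by under eq_fun do rewrite /= addr0.
Qed.

Lemma ft_differentiable0 x : K x -> differentiable (ft ^~ x) 0.
Proof.
move=> Kx; have [+ _] := A_ft_C1 AA (A_Ox_K AA Kx).
by apply; apply: beta_ball_Od; rewrite normr0 ltW.
Qed.

Lemma gt_differentiable0 x i : K x -> differentiable (fun d => gt d x 0 i) 0.
Proof.
move=> Kx; have [+ _] := A_gt_C1 AA i (A_Ox_K AA Kx).
by apply; apply: beta_ball_Od; rewrite normr0 ltW.
Qed.

(** A nonnegative Lagrangian on [K] near [l], vanishing at [l], has
    nonnegative directional derivatives there.  The function [q] is not
    differentiable: its difference quotient is replaced by q y - q l, which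
    dominates it by convexity.  This convexity also makes the conclusion
    hold for all [y] in [K] and not only near [l].  With [tau = 0] only the
    constraints appear. *)
Lemma first_order_condition l tau (xi : 'rV[R]_m) (pi : 'rV[R]_p) r :
  K l -> 0 <= tau -> 0 < r ->
  (forall y, K y -> `|y - l| <= r ->
    0 <= tau * (ft (y - l) l - ft 0 l + q y - q l) +
      (\sum_i xi 0 i * (gt (y - l) l 0 i - g l 0 i) + dotv pi ((y - l) *m 'J h l))) ->
  forall y, K y ->
    0 <= tau * (dotv (grad f l) (y - l) + q y - q l) +
      (dotv xi ((y - l) *m 'J g l) + dotv pi ((y - l) *m 'J h l)).
Proof.
move=> Kl tau0 r0 loc y Ky; pose w := y - l.
pose Q t := tau * (t^-1 * (ft (t *: w) l - ft 0 l) + q y - q l) +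
  (\sum_i xi 0 i * (t^-1 * (gt (t *: w) l 0 i - gt 0 l 0 i)) + dotv pi (w *m 'J h l)).
have Qcvg : Q t @[t --> 0^'+] --> tau * (dotv (grad f l) w + q y - q l) +
    (dotv xi (w *m 'J g l) + dotv pi (w *m 'J h l)).
  apply: cvgD; [apply: cvgM; first exact: cvg_cst|].
    apply: cvgD; [apply: cvgD|]; [|exact: cvg_cst|exact: cvg_cst].
    rewrite -(A4 AA Kl); exact: right_difference_quotient (ft_differentiable0 Kl).
  apply: cvgD; last exact: cvg_cst.
  apply: cvg_sumr => i; apply: cvgM; first exact: cvg_cst.
  rewrite -grad_coord; last exact: g_differentiable.
  rewrite -(A9 AA i Kl).
  exact: right_difference_quotient (gt_differentiable0 i Kl).
apply: (cvgr_to_ge Qcvg); near=> t.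
have t0 : 0 < t by near: t; exact: nbhs_right_gt.
have t1 : t <= 1 by near: t; exact: nbhs_right_le.
have t01 : 0 <= t <= 1 by rewrite ltW.
have Kt := convexK t01 Ky Kl.
have tE : t *: y + (1 - t) *: l - l = t *: w by apply/rowP => i; rewrite !mxE; ring.
have := loc _ Kt; rewrite tE normrZ gtr0_norm// => /(_ _)/le_trans H.
rewrite -(pmulr_rge0 _ t0); apply: H.
  rewrite (@le_trans _ _ (t * (`|w| + 1)))//; first by rewrite ler_pM2l// lerDl.
  rewrite -ler_pdivlMr; last by rewrite ltr_wpDl.
  by near: t; apply: nbhs_right_le; rewrite divr_gt0// ltr_wpDl.
have gt_scaled : t * \sum_i xi 0 i * (t^-1 * (gt (t *: w) l 0 i - gt 0 l 0 i)) =
    \sum_i xi 0 i * (gt (t *: w) l 0 i - g l 0 i).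
  rewrite mulr_sumr; apply: eq_bigr => i _; rewrite mulrCA; congr (_ * _).
  by rewrite mulrA divff ?gt_eqF// mul1r gt_at0.
rewrite /Q !(mulrDr t) gt_scaled -scalemxAl dotvZr lerD2r.
rewrite mulrCA ler_wpM2l// mulrBr mulrDr mulrA divff ?gt_eqF// mul1r.
by have := q_convex t01 Ky Kl; lra.
Unshelve. all: by end_near. Qed.

Local Notation M0 := (M0 K g h).
Local Notation M1 := (M1 K f q g h).
Local Notation eMFCQ := (eMFCQ K g h).

(** Membership in the normal cone of the orthant amounts to sign conditions
    and complementarity, and the normal vector to [K] is the opposite of the
    combination of the constraint gradients. *)
Lemma M0_intro l (xi : 'rV[R]_m) (pi : 'rV[R]_p) : K l ->
  (forall i, 0 <= xi 0 i) -> 0 <= \sum_i xi 0 i * (g l 0 i - phi l) ->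
  (forall v : 'rV[R]_p, `|v| <= phi l -> dotv pi (v - h l) <= 0) ->
  (forall y, K y -> 0 <= dotv xi ((y - l) *m 'J g l) + dotv pi ((y - l) *m 'J h l)) ->
  M0 l (xi, pi).
Proof.
move=> Kl xi0 xig piN stat; split => /=.
- split=> [i|u u0].
    by rewrite !mxE subr_le0; exact: le_max_violation_l.
  rewrite /dotv -subr_ge0 sub0r -sumrN (le_trans xig)// ler_sum// => i _.
  by rewrite -mulrN ler_wpM2l// !mxE; have := u0 i; lra.
- have hphi : `|h l| <= phi l.
    apply: norm_le_coord => [|j]; first exact: max_violation_ge0.
    exact: le_max_violation_r.
  have inball (v : 'rV[R]_p) :
      scale_set (phi l) (unit_ball_inf (p := p)) v <-> `|v| <= phi l.
    split=> [[u u1 <-]|v_phi].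
      rewrite normrZ ger0_norm ?max_violation_ge0// ler_piMr ?max_violation_ge0//.
    have [phi0|phi_neq0] := eqVneq (phi l) 0.
      exists 0; first by rewrite /unit_ball_inf /= normr0.
      move: v_phi; rewrite phi0 normr_le0 scale0r => /eqP ->//.
    exists ((phi l)^-1 *: v); last by rewrite scalerA divff// scale1r.
    rewrite /unit_ball_inf /= normrZ normfV ger0_norm ?max_violation_ge0//.
    by rewrite ler_pdivrMl ?mulr1// lt0r phi_neq0 max_violation_ge0.
  split; first exact/inball.
  by move=> v /inball; exact: piN.
- exists (- (xi *m ('J g l)^T + pi *m ('J h l)^T)); last by rewrite subrr.
  split=> // y Ky; rewrite dotvNl dotvDl !dotv_mul_tr oppr_le0; exact: stat.
Qed.

Lemma eMFCQ_trivial l xi pi : eMFCQ l -> M0 l (xi, pi) -> xi = 0 /\ pi = 0.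
Proof. by move=> [_ ->] [-> ->]. Qed.

(** [subdifferential] only involves points of [K], so that it already contains
    the normal cone to [K]: the normal vector can be taken to be 0. *)
Lemma M1_intro l (xi : 'rV[R]_m) (pi : 'rV[R]_p) : K l ->
  feasible g h l ->
  (forall i, 0 <= xi 0 i) -> 0 <= \sum_i xi 0 i * g l 0 i ->
  (forall y, K y -> 0 <= dotv (grad f l) (y - l) + q y - q l +
      (dotv xi ((y - l) *m 'J g l) + dotv pi ((y - l) *m 'J h l))) ->
  M1 l (xi, pi).
Proof.
move=> Kl [gl hl] xi0 xig stat; split => //=.
- split=> [//|u u0].
  rewrite /dotv -subr_ge0 sub0r -sumrN (le_trans xig)// ler_sum// => i _.
  by rewrite -mulrN ler_wpM2l// !mxE; have := u0 i; lra.
- pose s := grad f l + (xi *m ('J g l)^T + pi *m ('J h l)^T).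
  exists (- s), 0; split.
  + split=> // y Ky; have := stat y Ky.
    rewrite dotvNl /s !dotvDl !dotv_mul_tr; lra.
  + by split=> // y Ky; rewrite -(scale0r (0 : 'rV[R]_n)) dotvZl mul0r.
  + by rewrite /s !opprD; apply/rowP => i; rewrite !mxE; ring.
Qed.

(** * Consequences of eMFCQ near a point *)

Lemma feasible_phi0 x : phi x = 0 -> feasible g h x.
Proof.
move=> phi0; split=> [i|].
  by rewrite -phi0; exact: le_max_violation_l.
apply/rowP => j; rewrite mxE; apply/eqP; rewrite -normr_le0 -phi0.
exact: le_max_violation_r.
Qed.

Lemma gt_shift_cvg {T : Type} (G : set_system T) {GG : Filter G}
    (u v : T -> 'rV[R]_n) y x i : K x -> u @ G --> y -> v @ G --> x ->
  gt (u t - v t) (v t) 0 i @[t --> G] --> gt (y - x) x 0 i.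
Proof. by move=> Kx uy vx; apply: gt_cvg => //; exact: cvgB. Qed.

Lemma ht_shift_cvg {T : Type} (G : set_system T) {GG : Filter G}
    (u v : T -> 'rV[R]_n) y x j : K x -> u @ G --> y -> v @ G --> x ->
  ht h (u t - v t) (v t) 0 j @[t --> G] --> ht h (y - x) x 0 j.
Proof. by move=> Kx uy vx; apply: ht_cvg => //; exact: cvgB. Qed.

Lemma ft_shift_cvg {T : Type} (G : set_system T) {GG : Filter G}
    (u v : T -> 'rV[R]_n) y x : K x -> `|y - x| <= beta ->
  u @ G --> y -> v @ G --> x ->
  ft (u t - v t) (v t) @[t --> G] --> ft (y - x) x.
Proof. by move=> Kx yx uy vx; apply: ft_cvg => //; exact: cvgB. Qed.

(** Radius [rho / 2] makes the difference of two points of [patch l] an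
    admissible displacement for the definition of [kappa].  Working with the
    points [y = x + d] of this fixed set, instead of the displacements [d],
    gives systems whose domain does not depend on the parameter [x]. *)
Definition patch l : set 'rV[R]_n := K `&` cball l (rho / 2).

Lemma rho_gt0 : 0 < rho. Proof. by have /andP[] := rhob. Qed.

Lemma patch_center l : K l -> patch l l.
Proof. by move=> Kl; split => //; rewrite /cball /= subrr normr0 divr_ge0// ltW// rho_gt0. Qed.

Lemma patch_compact l : compact (patch l).
Proof.
by rewrite /patch setIC; apply: compact_closedI => //; exact: compact_cball.
Qed.

Lemma patch_convex l : convex_set (patch l).
Proof. by apply: convex_setI => //; exact: convex_cball. Qed.

Lemma patch_dist l x y : patch l x -> patch l y -> `|y - x| <= rho.
Proof.
move=> [_ xl] [_ yl]; rewrite -(subrKA l) (le_trans (ler_normD _ _))//.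
by rewrite (splitr rho) lerD// distrC.
Qed.

Lemma patch_dist_beta l x y : patch l x -> patch l y -> `|y - x| <= beta.
Proof. by move=> /patch_dist H /H /le_trans; apply; exact: rho_le_beta. Qed.

Lemma patch_near l x (d : R) : K x -> `|x - l| < Num.min d (rho / 2) ->
  patch l x /\ `|x - l| < d.
Proof. by move=> Kx; rewrite lt_min => /andP[xd /ltW]. Qed.

Lemma gt_shift_convex l x y z t i : patch l x -> patch l y -> patch l z ->
  0 <= t <= 1 ->
  gt (t *: y + (1 - t) *: z - x) x 0 i <=
    t * gt (y - x) x 0 i + (1 - t) * gt (z - x) x 0 i.
Proof.
move=> px py pz t01; rewrite convB.
by apply: gt_convex => //; [exact: px.1|exact: patch_dist_beta px _..].
Qed.

Lemma ht_shift_affine x y z t j :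
  ht h (t *: y + (1 - t) *: z - x) x 0 j =
    t * ht h (y - x) x 0 j + (1 - t) * ht h (z - x) x 0 j.
Proof. by rewrite convB ht_conv conv_coord. Qed.

Lemma ft_shift_convex l x y z t : patch l x -> patch l y -> patch l z ->
  0 <= t <= 1 ->
  ft (t *: y + (1 - t) *: z - x) x <=
    t * ft (y - x) x + (1 - t) * ft (z - x) x.
Proof.
move=> px py pz t01; rewrite convB.
by apply: ft_convex => //; [exact: px.1|exact: patch_dist_beta px _..].
Qed.

Let constraints (c : 'I_m + 'I_p) y x :=
  match c with inl i => gt (y - x) x 0 i | inr j => ht h (y - x) x 0 j end.

Let is_equality (c : 'I_m + 'I_p) := if c is inr _ then true else false.

Lemma constraints_convex l x : patch l x ->
  convex_system is_equality (patch l) (fun c y => constraints c y x).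
Proof.
move=> px; split=> [[i|j]|[i|j] t y z t01 py pz /=].
- apply: continuous_subspaceT => y.
  apply: (@gt_shift_cvg _ (nbhs y) _ id (fun=> x) y x i px.1).
    exact: cvg_id.
  exact: cvg_cst.
- apply: continuous_subspaceT => y.
  apply: (@ht_shift_cvg _ (nbhs y) _ id (fun=> x) y x j px.1).
    exact: cvg_id.
  exact: cvg_cst.
- exact: gt_shift_convex px py pz t01.
- exact: ht_shift_affine.
Qed.

Lemma constraints_continuous l y c : K l -> {for l, continuous (constraints c y)}.
Proof.
move=> Kl; case: c => [i|j].
  apply: (@gt_shift_cvg _ (nbhs l) _ (fun=> y) id y l i Kl); first exact: cvg_cst.
  exact: cvg_id.
apply: (@ht_shift_cvg _ (nbhs l) _ (fun=> y) id y l j Kl); first exact: cvg_cst.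
exact: cvg_id.
Qed.

Lemma constraints_sum nu y l : h l = 0 ->
  \sum_c nu c * constraints c y l =
  \sum_i (\row_i nu (inl i)) 0 i * gt (y - l) l 0 i +
  dotv (\row_j nu (inr j)) ((y - l) *m 'J h l).
Proof.
move=> hl; rewrite big_sumType /=; congr (_ + _).
  by apply: eq_bigr => i _; rewrite mxE.
by apply: eq_bigr => j _; rewrite [in RHS]mxE /ht hl add0r.
Qed.

(** Fritz John multipliers of the constraints at [l] would form a nonzero
    element of [M0 l]; complementarity is obtained by evaluating the
    multiplier inequality at [l] itself. *)
Lemma eMFCQ_interior l : eMFCQ l -> phi l = 0 ->
  exists2 d, 0 < d & forall x (v : 'rV[R]_p), K x -> `|x - l| < d -> `|v| <= d ->
    exists y, [/\ K y, `|y - x| <= rho, forall i, gt (y - x) x 0 i <= - d &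
      ht h (y - x) x = v].
Proof.
move=> emf phi0; have Kl := emf.1; have [gl hl] := feasible_phi0 phi0.
have [[d d0 sol]|[nu [[c nuc] nu0 nusum]]] :=
  @parametric_alternative _ _ _ is_equality (patch l)
    (ex_intro _ l (patch_center Kl)) (@patch_compact l)
    (@patch_convex l) (patch l) constraints l (@constraints_convex l)
    (fun c y _ => @constraints_continuous l y c Kl).
- exists (Num.min d (rho / 2)).
    by rewrite lt_min d0 divr_gt0// rho_gt0.
  move=> x v Kx /patch_near - /(_ Kx)[px xd] vd.
  have [|y py ysat] := sol x (fun c => if c is inr j then v 0 j else - d) px xd.
    case=> //= j; rewrite (le_trans (ler_coord_norm _ _))// (le_trans vd)//.
    by rewrite ge_min lexx.
  exists y; split; [exact: py.1|exact: patch_dist px py| |].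
    move=> i; rewrite (le_trans (ysat (inl i)))// lerN2 ge_min lexx//.
  by apply/rowP => j; exact: (ysat (inr j)).
- pose xi := \row_i nu (inl i); pose pi := \row_j nu (inr j).
  have xi0 i : 0 <= xi 0 i by rewrite mxE; exact: nu0.
  have xig : \sum_i xi 0 i * g l 0 i <= 0.
    by apply: sumr_le0 => i _; rewrite mulr_ge0_le0.
  have [xiE piE] : xi = 0 /\ pi = 0.
    apply: (eMFCQ_trivial emf); apply: M0_intro => //.
    + have := nusum l (patch_center Kl).
      rewrite constraints_sum// subrr mul0mx dotv0r addr0 gt_at0//.
      by rewrite phi0; under [in X in _ -> X]eq_bigr do rewrite subr0.
    + move=> v; rewrite phi0 normr_le0 hl => /eqP ->.
      by rewrite subrr dotv0r.
    + move=> y Ky.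
      have := @first_order_condition l 0 xi pi (rho / 2) Kl (lexx _) _ _ y Ky.
      rewrite mul0r add0r; apply; first by rewrite divr_gt0// rho_gt0.
      move=> z Kz zl; rewrite mul0r add0r.
      have := nusum z (conj Kz zl); rewrite constraints_sum// -/xi -/pi.
      under [X in _ -> 0 <= X + _]eq_bigr do rewrite mulrBr.
      by rewrite sumrB; lra.
  move: nuc; case: c => [i|j].
    by have /rowP/(_ i) := xiE; rewrite !mxE => ->; rewrite eqxx.
  by have /rowP/(_ j) := piE; rewrite !mxE => ->; rewrite eqxx.
Qed.

Let cost_change y x := ft (y - x) x - ft 0 x + q y - q x.

Lemma cost_change_cvg {T : Type} (G : set_system T) {GG : Filter G}
    (u v : T -> 'rV[R]_n) y x : K x -> K y -> `|y - x| <= beta ->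
  u @ G --> y -> v @ G --> x ->
  cost_change (u t) (v t) @[t --> G] --> cost_change y x.
Proof.
move=> Kx Ky yx uy vx; have b0 : `|0 : 'rV[R]_n| <= beta by rewrite normr0 ltW.
apply: cvgB; last exact: q_cvg.
apply: cvgD; last exact: q_cvg.
apply: cvgB; first exact: ft_shift_cvg.
exact: (@ft_cvg _ _ _ (fun=> 0) v 0 x b0 Kx (cvg_cst _) vx).
Qed.

(** The system of [eMFCQ_interior] with the decrease of the model cost as an
    additional inequality.  A positive multiplier [tau] of that inequality
    would give KKT multipliers after division by [tau], and [tau = 0] would
    contradict eMFCQ. *)
Lemma descent_near_nonKKT l : eMFCQ l -> phi l = 0 -> ~ KKT K f q g h l ->
  exists2 d, 0 < d & forall x, K x -> `|x - l| < d ->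
    exists y, [/\ K y, `|y - x| <= rho, cost_change y x <= - d,
      forall i, gt (y - x) x 0 i <= 0 & ht h (y - x) x = 0].
Proof.
move=> emf phi0 nKKT; have Kl := emf.1; have [gl hl] := feasible_phi0 phi0.
pose F (c : unit + ('I_m + 'I_p)) y x :=
  match c with inl _ => cost_change y x | inr c => constraints c y x end.
pose e (c : unit + ('I_m + 'I_p)) := if c is inr c then is_equality c else false.
have Fconvex x : patch l x -> convex_system e (patch l) (fun c y => F c y x).
  move=> px; have [ctF cvxF] := constraints_convex px.
  split=> [[u | c] | [u | c] t y z t01 py pz] /=; last exact: cvxF.
  - apply: continuous_in_subspaceT => y /set_mem py.
    apply: (@cost_change_cvg _ (nbhs y) _ id (fun=> x) y x px.1 py.1
      (patch_dist_beta px py)); first exact: cvg_id.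
    exact: cvg_cst.
  - exact: ctF.
  - have := ft_shift_convex px py pz t01; have := q_convex t01 py.1 pz.1.
    rewrite /cost_change; lra.
have Fcont c y : patch l y -> {for l, continuous (F c y)}.
  move=> py; case: c => [u|c]; last exact: (@constraints_continuous l y c Kl).
  apply: (@cost_change_cvg _ (nbhs l) _ (fun=> y) id y l Kl py.1
    (patch_dist_beta (patch_center Kl) py)); first exact: cvg_cst.
  exact: cvg_id.
have [[d d0 sol]|[nu [[c nuc] nu0 nusum]]] :=
  @parametric_alternative _ _ _ e (patch l) (ex_intro _ l (patch_center Kl))
    (@patch_compact l) (@patch_convex l) (patch l) F l Fconvex Fcont.
- exists (Num.min d (rho / 2)).
    by rewrite lt_min d0 divr_gt0// rho_gt0.
  move=> x Kx /patch_near - /(_ Kx)[px xd].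
  have [|y py ysat] := sol x (fun c => if e c then 0 else - d) px xd.
    by move=> c; case: (e c) => //; rewrite normr0 ltW.
  exists y; split; [exact: py.1|exact: patch_dist px py| | |].
  + by rewrite (le_trans (ysat (inl tt)))// lerN2 ge_min lexx.
  + by move=> i; rewrite (le_trans (ysat (inr (inl i))))// oppr_le0 ltW.
  + by apply/rowP => j; rewrite [RHS]mxE; exact: (ysat (inr (inr j))).
- exfalso; pose tau := nu (inl tt).
  pose xi := \row_i nu (inr (inl i)); pose pi := \row_j nu (inr (inr j)).
  have tau0 : 0 <= tau by exact: nu0.
  have xi0 i : 0 <= xi 0 i by rewrite mxE; exact: nu0.
  have xig : \sum_i xi 0 i * g l 0 i <= 0.
    by apply: sumr_le0 => i _; rewrite mulr_ge0_le0.
  have Fsum y : \sum_c nu c * F c y l = tau * cost_change y l +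
      (\sum_i xi 0 i * gt (y - l) l 0 i + dotv pi ((y - l) *m 'J h l)).
    rewrite big_sumType /=; congr (_ + _); first by rewrite (big_pred1 tt)//; case.
    exact: (constraints_sum (nu \o inr) y hl).
  have xig0 : 0 <= \sum_i xi 0 i * g l 0 i.
    have := nusum l (patch_center Kl); rewrite Fsum.
    rewrite subrr mul0mx dotv0r addr0 gt_at0// /cost_change !subrr.
    by rewrite add0r subrr mulr0 add0r.
  have stat y : K y -> 0 <= tau * (dotv (grad f l) (y - l) + q y - q l) +
      (dotv xi ((y - l) *m 'J g l) + dotv pi ((y - l) *m 'J h l)).
    apply: (@first_order_condition l tau xi pi (rho / 2) Kl tau0).
      by rewrite divr_gt0// rho_gt0.
    move=> z Kz zl; have := nusum z (conj Kz zl); rewrite Fsum /cost_change.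
    under [X in _ -> 0 <= _ + (X + _)]eq_bigr do rewrite mulrBr.
    by rewrite sumrB; lra.
  have [tau_eq0|tau_neq0] := eqVneq tau 0.
    have [xiE piE] : xi = 0 /\ pi = 0.
      apply: (eMFCQ_trivial emf); apply: M0_intro => //.
      + by rewrite phi0; under eq_bigr do rewrite subr0.
      + move=> v; rewrite phi0 normr_le0 hl => /eqP ->.
        by rewrite subrr dotv0r.
      + by move=> y /stat; rewrite tau_eq0 mul0r add0r.
    move: nuc; case: c => [[]|[i|j]].
    + by rewrite -/tau tau_eq0 eqxx.
    + by have /rowP/(_ i) := xiE; rewrite !mxE => ->; rewrite eqxx.
    + by have /rowP/(_ j) := piE; rewrite !mxE => ->; rewrite eqxx.
  have tau_gt0 : 0 < tau by rewrite lt0r tau_neq0.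
  apply: nKKT; split => //; exists (tau^-1 *: xi, tau^-1 *: pi).
  apply: M1_intro => //.
  + by move=> i; rewrite mxE mulr_ge0// invr_ge0.
  + under eq_bigr do rewrite mxE -mulrA.
    by rewrite -mulr_sumr mulr_ge0// invr_ge0.
  + move=> y /stat H; rewrite -(pmulr_rge0 _ tau_gt0) !dotvZl.
    by rewrite mulrDr [X in _ + X]mulrDr !(mulrA tau) divff// !mul1r.
Qed.

(** At an infeasible point each equality is relaxed to the two inequalities
    [h <= phi] and [- h <= phi], with multipliers [a] and [b], so that the
    system has no equality.  The multiplier of the equality is [a - b]; once
    it vanishes, complementarity gives - 2 phi (sum of the [a j]) >= 0, so
    that [a] and [b] vanish too because [phi] is positive. *)
Lemma violation_decrease l : eMFCQ l -> 0 < phi l ->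
  exists2 d, 0 < d & forall x, K x -> `|x - l| < d ->
    exists y, [/\ K y, `|y - x| <= rho & viol (y - x) x <= phi x - d].
Proof.
move=> emf phi_gt0; have Kl := emf.1.
pose F (c : 'I_m + ('I_p + 'I_p)) y x :=
  match c with
  | inl i => gt (y - x) x 0 i - phi x
  | inr (inl j) => ht h (y - x) x 0 j - phi x
  | inr (inr j) => - ht h (y - x) x 0 j - phi x
  end.
have Fconvex x : patch l x -> convex_system xpred0 (patch l) (fun c y => F c y x).
  move=> px; have [ctF cvxF] := constraints_convex px.
  split=> [[i|[j|j]] | [i|[j|j]] t y z t01 py pz] /=.
  - by move=> y; apply: cvgB; [exact: (ctF (inl i))|exact: cvg_cst].
  - by move=> y; apply: cvgB; [exact: (ctF (inr j))|exact: cvg_cst].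
  - by move=> y; apply: cvgB; [apply: cvgN; exact: (ctF (inr j))|exact: cvg_cst].
  - have := cvxF (inl i) t y z t01 py pz => /=; lra.
  - have := cvxF (inr j) t y z t01 py pz => /= ->; lra.
  - have := cvxF (inr j) t y z t01 py pz => /= ->; lra.
have Fcont c y : patch l y -> {for l, continuous (F c y)}.
  move=> py; have phic : phi x @[x --> l] --> phi l.
    exact: phi_continuous.
  have cc c' : {for l, continuous (constraints c' y)}.
    exact: constraints_continuous.
  case: c => [i|[j|j]].
  - exact: (cvgB (cc (inl i)) phic).
  - exact: (cvgB (cc (inr j)) phic).
  - exact: (cvgB (cvgN (cc (inr j))) phic).
have [[d d0 sol]|[nu [[c nuc] nu0 nusum]]] :=
  @parametric_alternative _ _ _ xpred0 (patch l) (ex_intro _ l (patch_center Kl))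
    (@patch_compact l) (@patch_convex l) (patch l) F l Fconvex Fcont.
- have [r r0 phi_near] : exists2 r, 0 < r &
      forall x, `|x - l| < r -> phi l / 2 < phi x.
    have phic : phi x @[x --> l] --> phi l.
      exact: phi_continuous.
    have /nbhs_ballP[r /= r0 Hr] := cvgr_gt (phi l) phic (phi l / 2)
      ltac:(by rewrite gtr_pMr// invf_lt1// ltr1n).
    by exists r => // x xl; apply: Hr; rewrite -ball_normE /= distrC.
  pose D := Num.min (Num.min d r) (phi l / 2).
  exists (Num.min D (rho / 2)).
    by rewrite !lt_min d0 r0 !divr_gt0// rho_gt0.
  move=> x Kx /patch_near - /(_ Kx)[px].
  rewrite !lt_min => /andP[/andP[xd xr] _].
  have [|y py ysat] := sol x (fun=> - d) px xd; first by [].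
  exists y; split; [exact: py.1|exact: patch_dist px py|].
  have Dd : Num.min D (rho / 2) <= d by rewrite !ge_min lexx.
  have Dphi : Num.min D (rho / 2) <= phi l / 2 by rewrite !ge_min lexx !orbT.
  apply/max_violation_le; split=> [|i|j].
  + by rewrite subr_ge0 (le_trans Dphi)// ltW// phi_near.
  + have := ysat (inl i) => /=; lra.
  + have := ysat (inr (inl j)) => /=; have := ysat (inr (inr j)) => /=.
    by rewrite ler_norml => ? ?; apply/andP; split; lra.
- exfalso; pose a j := nu (inr (inl j)); pose b j := nu (inr (inr j)).
  pose xi := \row_i nu (inl i); pose pi := \row_j (a j - b j).
  have xi0 i : 0 <= xi 0 i by rewrite mxE; exact: nu0.
  have a0 j : 0 <= a j by exact: nu0.
  have b0 j : 0 <= b j by exact: nu0.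
  have hphi j : `|h l 0 j| <= phi l by exact: le_max_violation_r.
  have Fsum y : \sum_c nu c * F c y l =
      \sum_i xi 0 i * (gt (y - l) l 0 i - phi l) +
      (\sum_j a j * (ht h (y - l) l 0 j - phi l) +
       \sum_j b j * (- ht h (y - l) l 0 j - phi l)).
    rewrite !big_sumType /=; congr (_ + _).
    by apply: eq_bigr => i _; rewrite mxE.
  pose S1 := \sum_i xi 0 i * (g l 0 i - phi l).
  pose S2 := \sum_j a j * (h l 0 j - phi l).
  pose S3 := \sum_j b j * (- h l 0 j - phi l).
  (* all three sums are nonpositive with a nonnegative total, hence zero *)
  have S10 : S1 <= 0.
    apply: sumr_le0 => i _; rewrite mulr_ge0_le0// subr_le0.
    exact: le_max_violation_l.
  have S20 : S2 <= 0.
    apply: sumr_le0 => j _; rewrite mulr_ge0_le0// subr_le0.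
    exact: le_trans (ler_norm _) (hphi j).
  have S30 : S3 <= 0.
    apply: sumr_le0 => j _; rewrite mulr_ge0_le0// subr_le0.
    by rewrite (le_trans (ler_norm _))// normrN.
  have S0 : 0 <= S1 + (S2 + S3).
    have := nusum l (patch_center Kl).
    by rewrite Fsum subrr ht_at0 gt_at0.
  have [xiE piE] : xi = 0 /\ pi = 0.
    apply: (eMFCQ_trivial emf); apply: M0_intro => //.
    + by rewrite -/S1; lra.
    + move=> v vphi.
      have -> : dotv pi (v - h l) = \sum_j a j * (v 0 j - phi l) - S2 +
          (\sum_j b j * (- v 0 j - phi l) - S3).
        rewrite /dotv /S2 /S3 -!sumrB -big_split /=; apply: eq_bigr => j _.
        by rewrite !mxE; ring.
      have V j : - phi l <= v 0 j <= phi l.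
        by rewrite -ler_norml (le_trans (ler_coord_norm _ _)).
      have : \sum_j a j * (v 0 j - phi l) <= 0.
        apply: sumr_le0 => j _; rewrite mulr_ge0_le0//.
        by have /andP[] := V j; lra.
      have : \sum_j b j * (- v 0 j - phi l) <= 0.
        apply: sumr_le0 => j _; rewrite mulr_ge0_le0//.
        by have /andP[] := V j; lra.
      lra.
    + move=> y Ky.
      have := @first_order_condition l 0 xi pi (rho / 2) Kl (lexx _) _ _ y Ky.
      rewrite mul0r add0r; apply; first by rewrite divr_gt0// rho_gt0.
      move=> z Kz zl; rewrite mul0r add0r.
      have := nusum z (conj Kz zl); rewrite Fsum.
      have -> : \sum_i xi 0 i * (gt (z - l) l 0 i - phi l) =
          \sum_i xi 0 i * (gt (z - l) l 0 i - g l 0 i) + S1.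
        by rewrite -big_split /=; apply: eq_bigr => i _; ring.
      have -> : \sum_j a j * (ht h (z - l) l 0 j - phi l) +
          \sum_j b j * (- ht h (z - l) l 0 j - phi l) =
          dotv pi ((z - l) *m 'J h l) + (S2 + S3).
        rewrite /S2 /S3 /dotv -!big_split /=; apply: eq_bigr => j _.
        by rewrite /ht !mxE; ring.
      lra.
  have ab j : b j = a j.
    by have /rowP/(_ j) := piE; rewrite !mxE => /subr0_eq.
  have aS : \sum_j a j = 0.
    apply/eqP; rewrite eq_le sumr_ge0// andbT.
    have : S2 + S3 = - (2 * phi l) * \sum_j a j.
      rewrite /S2 /S3 -big_split /= mulr_sumr; apply: eq_bigr => j _.
      by rewrite ab; ring.
    move=> S23; have : 0 <= - (2 * phi l) * \sum_j a j by rewrite -S23; lra.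
    by rewrite mulNr oppr_ge0 pmulr_rle0// mulr_gt0.
  have aE j : a j = 0.
    have /psumr_eq0P := aS; by apply.
  move: nuc; case: c => [i|[j|j]].
  + by have /rowP/(_ i) := xiE; rewrite !mxE => ->; rewrite eqxx.
  + by rewrite -/(a j) aE eqxx.
  + by rewrite -/(b j) ab aE eqxx.
Qed.

Local Notation KKT := (KKT K f q g h).

Lemma cvg_dist_lt_harmonic (x : nat -> 'rV[R]_n) l :
  (forall k, `|x k - l| < k.+1%:R^-1) -> x @ \oo --> l.
Proof.
move=> xl; apply/cvgrPdist_lt => e e0; near=> k.
rewrite distrC (lt_trans (xl k))//.
near: k; exact: near_infty_natSinv_lt (PosNum e0).
Unshelve. all: by end_near. Qed.

(** Two contradictions with [dsol (x k)] tending to 0: if [l] is infeasible,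
    the violation at [dsol (x k)] stays below [phi (x k)] by a fixed amount,
    whereas both tend to [phi l]; if [l] is feasible but not KKT, the optimal
    cost stays below the cost of [0] by a fixed amount. *)
Lemma KKT_limit l (x : nat -> 'rV[R]_n) : eMFCQ l -> (forall k, K (x k)) ->
  x @ \oo --> l -> dsol (x k) @[k --> \oo] --> (0 : 'rV[R]_n) -> KKT l.
Proof.
move=> emf Kx xl d0; have Kl := emf.1.
have b0 : `|0 : 'rV[R]_n| <= beta by rewrite normr0 ltW.
have close (d : R) : 0 < d -> \forall k \near \oo, `|x k - l| < d.
  move=> dpos; have /cvgrPdist_lt/(_ d dpos) := xl.
  by apply: filterS => k; rewrite distrC.
have [phi_gt0|] := ltP 0 (phi l).
  have [d dpos dec] := violation_decrease emf phi_gt0.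
  have ld : 0 < lambda * d by rewrite mulr_gt0//; have /andP[] := lam01.
  have ineq : \forall k \near \oo, viol (dsol (x k)) (x k) <= phi (x k) - lambda * d.
    have := close d dpos; apply: filterS => k xk.
    have [y [Ky yx yviol]] := dec _ (Kx k) xk.
    have [dk _ _] := dsol_feasible (Kx k); apply: (le_trans dk).
    have [_ [_ _ _ least]] := least_violP (Kx k).
    have : least_viol (x k) <= phi (x k) - d.
      by rewrite (le_trans _ yviol)// least// addrC subrK.
    move=> lv; suff : lambda * d <= phi (x k) - kappa (x k) by lra.
    by rewrite kappa_gap ler_wpM2l//; [have /andP[/ltW] := lam01|lra].
  have lim1 : viol (dsol (x k)) (x k) @[k --> \oo] --> viol 0 l by exact: viol_cvg.
  have lim2 : phi (x k) - lambda * d @[k --> \oo] --> phi l - lambda * d.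
    by apply: cvgB; [exact: phi_cvg|exact: cvg_cst].
  have : viol 0 l <= phi l - lambda * d by exact: (ler_cvg_to lim1 lim2 ineq).
  by rewrite viol_at0// lerBrDr gerDl leNgt ld.
move=> phi_le0; have phi0 : phi l = 0.
  by apply/eqP; rewrite eq_le phi_le0 max_violation_ge0.
apply: contrapT => nKKT.
have [d dpos dec] := descent_near_nonKKT emf phi0 nKKT.
have ineq : \forall k \near \oo,
    ft (dsol (x k)) (x k) + q (x k + dsol (x k)) <= ft 0 (x k) + q (x k) - d.
  have := close d dpos; apply: filterS => k xk.
  have [y [Ky yx ycost ygt yht]] := dec _ (Kx k) xk.
  have yE : x k + (y - x k) = y by rewrite addrC subrK.
  rewrite (le_trans (dsol_optimal (Kx k) (d := y - x k) _ _ _)) ?yE//.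
  - apply: (le_trans _ (kappa_ge0 (Kx k))); apply/max_violation_le; split=> //.
    by move=> j; rewrite yht mxE normr0.
  - by rewrite (le_trans yx)// rho_le_beta.
  - by move: ycost; rewrite /cost_change; lra.
have lim1 : ft (dsol (x k)) (x k) + q (x k + dsol (x k)) @[k --> \oo] -->
    ft 0 l + q l.
  apply: cvgD; first exact: ft_cvg.
  by apply: q_cvg => //; rewrite -[X in _ --> X]addr0; exact: cvgD.
have lim2 : ft 0 (x k) + q (x k) - d @[k --> \oo] --> ft 0 l + q l - d.
  apply: cvgB; last exact: cvg_cst.
  apply: cvgD; last exact: q_cvg.
  exact: (@ft_cvg _ _ _ (fun=> 0) x 0 l b0 Kl (cvg_cst _) xl).
have : ft 0 l + q l <= ft 0 l + q l - d by exact: (ler_cvg_to lim1 lim2 ineq).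
by rewrite lerBrDr gerDl leNgt dpos.
Qed.

(** * Decrease of the penalty function near a point *)

(** By compactness of the admissible displacements. *)
Lemma local_cost_bound l : K l -> exists2 B, 0 <= B & exists2 r, 0 < r &
  forall x y, K x -> `|x - l| < r -> K y -> `|y - x| <= beta ->
    cost_change y x <= B.
Proof.
move=> Kl; apply: contrapT => nobound.
have step (k : nat) : exists z : 'rV[R]_n * 'rV[R]_n,
    [/\ K z.1, `|z.1 - l| < k.+1%:R^-1, K z.2, `|z.2 - z.1| <= beta &
      k%:R < cost_change z.2 z.1].
  apply: contrapT => /forallNP nostep; apply: nobound.
  exists k%:R => //; exists k.+1%:R^-1; first by rewrite invr_gt0.
  move=> x y Kx xl Ky yx; rewrite leNgt; apply/negP => cost.
  by apply: (nostep (x, y)); split.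
have [z zP] := choice step.
have zl : (z k).1 @[k --> \oo] --> l.
  by apply: cvg_dist_lt_harmonic => k; have [] := zP k.
have [||y [_ Ky] [s s_incr zy]] :=
    @compact_subseq _ _ (cball l (beta + 1) `&` K) (fun k => (z k).2).
- by apply: compact_closedI => //; exact: compact_cball.
- move=> k; have [Kz1 z1l Kz2 z21 _] := zP k; split=> //; rewrite /cball /=.
  rewrite -(subrKA (z k).1) (le_trans (ler_normD _ _))// lerD//.
  by rewrite (le_trans (ltW z1l))// invf_le1// ler1n.
have zls : (z (s k)).1 @[k --> \oo] --> l by exact: cvg_comp (subseq_cvgn s_incr) zl.
have yl : `|y - l| <= beta.
  have : `|(z (s k)).2 - (z (s k)).1| @[k --> \oo] --> `|y - l|.
    by apply: cvg_norm; exact: cvgB.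
  by move=> /cvgr_to_le; apply; apply: nearW => k; have [] := zP (s k).
have cc : cost_change (z (s k)).2 (z (s k)).1 @[k --> \oo] --> cost_change y l.
  exact: cost_change_cvg.
have [|N _ HN] := cvgr_lt _ cc (cost_change y l + 1); first by rewrite ltrDl.
(* the costs along the subsequence converge, yet they exceed the indices *)
pose M := (Num.truncn `|cost_change y l + 1|).+1.
have HM : `|cost_change y l + 1| < M%:R by exact: truncnS_gt.
have := HN (maxn N M) (leq_maxl _ _) => /=.
have [_ _ _ _] := zP (s (maxn N M)).
have : M%:R <= (s (maxn N M))%:R :> R.
  by rewrite ler_nat (leq_trans (leq_maxr N M))// leq_strict_subseq.
have := ler_norm (cost_change y l + 1); lra.
Qed.

Lemma cost_change_scale s x y : 0 <= s <= 1 -> K x -> K y -> `|y - x| <= beta ->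
  cost_change (x + s *: (y - x)) x <= s * cost_change y x.
Proof.
move=> s01 Kx Ky yx; rewrite /cost_change.
have b0 : `|0 : 'rV[R]_n| <= beta by rewrite normr0 ltW.
have := ft_convex Kx s01 yx b0; rewrite scaler0 addr0.
have := q_convex s01 Ky Kx.
have -> : s *: y + (1 - s) *: x = x + s *: (y - x).
  by apply/rowP => i; rewrite !mxE; ring.
by rewrite [x + _ - x]addrC addKr; lra.
Qed.

Lemma dsol_cost_le x d : K x -> viol d x <= kappa x -> `|d| <= beta -> K (x + d) ->
  cost_change (x + dsol x) x <= cost_change (x + d) x.
Proof.
move=> Kx dk db Kd; have := dsol_optimal Kx dk db Kd.
by rewrite /cost_change ![x + _ - x]addrC !addKr; lra.
Qed.

Lemma scaled_step_in x y s : 0 <= s <= 1 -> K x -> K y -> K (x + s *: (y - x)).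
Proof.
move=> s01 Kx Ky; have := convexK s01 Ky Kx.
by congr K; apply/rowP => i; rewrite !mxE; ring.
Qed.

(** The key estimate.  The cost of [dsol x] is at most the cost of any
    feasible displacement.  At an infeasible [l] the displacement is
    [lambda] times one of least violation.  At a feasible [l] it is
    [s *: (y - x)] with [s] of the order of [phi x], which is feasible for
    the unrelaxed constraints; convexity makes its cost at most [s] times a
    bounded quantity. *)
Lemma cost_bounded_by_gap l : eMFCQ l -> exists2 C, 0 <= C & exists2 r, 0 < r &
  forall x, K x -> `|x - l| < r ->
    cost_change (x + dsol x) x <= C * (phi x - kappa x).
Proof.
move=> emf; have Kl := emf.1.
have [B B0 [r1 r10 cost_le]] := local_cost_bound Kl.
have /andP[lam_gt0 lam_lt1] := lam01.
have [phi_gt0|] := ltP 0 (phi l).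
  have [d d0 dec] := violation_decrease emf phi_gt0.
  exists (B / d); first by rewrite divr_ge0// ltW.
  exists (Num.min d r1); first by rewrite lt_min d0.
  move=> x Kx; rewrite lt_min => /andP[xd xr].
  have [y [Ky yx yviol]] := dec x Kx xd.
  have [e [er Ke eE least]] := least_violP Kx.
  have gap : lambda * d <= phi x - kappa x.
    rewrite kappa_gap ler_wpM2l ?(ltW lam_gt0)//.
    have : least_viol x <= phi x - d.
      by rewrite (le_trans _ yviol)// least// addrC subrK.
    lra.
  have /(sub_feasibleP _ Kx)[sk sb Ks] := scaled_least_viol_feasible Kx er Ke eE.
  have er' : `|(x + e) - x| <= beta by rewrite addrC addKr (le_trans er)// rho_le_beta.
  rewrite (le_trans (dsol_cost_le Kx sk sb Ks))//.
  have lam01' : 0 <= lambda <= 1 by rewrite (ltW lam_gt0) ltW.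
  have := cost_change_scale lam01' Kx Ke er'.
  rewrite [x + e - x]addrC addKr => /le_trans; apply.
  rewrite (@le_trans _ _ (lambda * B))//.
    by rewrite ler_wpM2l ?(ltW lam_gt0)// cost_le.
  have -> : lambda * B = B / d * (lambda * d).
    by rewrite mulrAC mulrCA -mulrA; field; rewrite gt_eqF.
  by rewrite ler_wpM2l// divr_ge0// ltW.
move=> phi_le0; have phi0 : phi l = 0.
  by apply/eqP; rewrite eq_le phi_le0 max_violation_ge0.
have [d d0 sol] := eMFCQ_interior emf phi0.
exists (B / (d * lambda)); first by rewrite divr_ge0// mulr_ge0// ltW.
exists (Num.min d r1); first by rewrite lt_min d0.
move=> x Kx; rewrite lt_min => /andP[xd xr].
pose t := phi x.
have t0 : 0 <= t by exact: max_violation_ge0.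
have hx : `|h x| <= t.
  by apply: norm_le_coord => // j; exact: le_max_violation_r.
(* the right-hand side for which the linearized equalities vanish at the
   point of parameter s = t / (t + d): s * (- d / t) + (1 - s) = 0 *)
have [|y [Ky yx ygt yht]] := sol x (- (d / t) *: h x) Kx xd.
  rewrite normrZ normrN ger0_norm ?divr_ge0 ?(ltW d0)//.
  have [->|t_neq0] := eqVneq t 0; first by rewrite invr0 mulr0 mul0r ltW.
  by rewrite mulrAC ler_pdivrMr ?lt0r ?t_neq0// ler_wpM2l// ltW.
have td : 0 < t + d by rewrite ltr_wpDl.
pose s := t / (t + d).
have s01 : 0 <= s <= 1.
  by rewrite divr_ge0 ?(ltW td)//= ler_pdivrMr// mul1r lerDl ltW.
have s1 : 1 - s = d / (t + d) by rewrite /s; field; rewrite gt_eqF.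
have yxb : `|y - x| <= beta by rewrite (le_trans yx)// rho_le_beta.
have b0 : `|0 : 'rV[R]_n| <= beta by rewrite normr0 ltW.
pose e := s *: (y - x).
have eE : e = s *: (y - x) + (1 - s) *: 0 by rewrite scaler0 addr0.
have eviol : viol e x <= 0.
  rewrite eE; apply/max_violation_le; split=> // [i|j].
    rewrite (le_trans (gt_convex _ Kx s01 yxb b0))// gt_at0//.
    have /andP[s0 s1'] := s01.
    have H1 : s * gt (y - x) x 0 i <= s * (- d) by rewrite ler_wpM2l.
    have H2 : (1 - s) * g x 0 i <= (1 - s) * t.
      by rewrite ler_wpM2l ?subr_ge0//; exact: le_max_violation_l.
    have E0 : s * (- d) + (1 - s) * t = 0 by rewrite s1 /s; field; rewrite gt_eqF.
    by rewrite -E0 lerD.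
  rewrite ht_conv ht_at0 yht normr_le0 conv_coord mxE s1 /s.
  have [t_eq0|t_neq0] := eqVneq t 0.
    have : h x = 0 by apply/eqP; rewrite -normr_le0 -t_eq0.
    by move=> ->; rewrite mxE !mulr0 addr0.
  by apply/eqP; field; rewrite t_neq0 gt_eqF.
have eb : `|e| <= rho.
  by rewrite eE; apply: norm_conv_le => //; rewrite normr0 ltW// rho_gt0.
have Ke : K (x + e) by exact: scaled_step_in.
have least0 : least_viol x <= 0.
  by have [_ [_ _ _ least]] := least_violP Kx; rewrite (le_trans _ eviol)// least.
have gap : lambda * t <= phi x - kappa x.
  by rewrite kappa_gap ler_wpM2l ?(ltW lam_gt0)// -/t; lra.
have ek : viol e x <= kappa x by exact: le_trans eviol (kappa_ge0 Kx).
have ebb : `|e| <= beta by rewrite (le_trans eb)// rho_le_beta.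
rewrite (le_trans (dsol_cost_le Kx ek ebb Ke))//.
rewrite (le_trans (cost_change_scale s01 Kx Ky yxb))//.
have /andP[s0 _] := s01.
rewrite (@le_trans _ _ (s * B))//; first by rewrite ler_wpM2l// cost_le.
rewrite (@le_trans _ _ (B / (d * lambda) * (lambda * t)))//; last first.
  by rewrite ler_wpM2l// divr_ge0// mulr_ge0// ltW.
have -> : B / (d * lambda) * (lambda * t) = t / d * B.
  by field; rewrite !gt_eqF.
by rewrite ler_wpM2r// /s ler_wpM2l// lef_pV2 ?posrE// lerDr.
Qed.

(** Bounds a directional derivative by the limit of a bound on the difference
    quotients, as provided by (strong) convexity along a segment. *)
Lemma slope_le (F : 'rV[R]_n -> R) (d : 'rV[R]_n) A B : differentiable F 0 ->
  (forall t, 0 < t <= 1 -> F (t *: d) - F 0 <= t * (A + t * B)) ->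
  dotv (grad F 0) d <= A.
Proof.
move=> dF slope; have lim1 := @right_difference_quotient F d dF.
have lim2 : A + t * B @[t --> 0^'+] --> A + 0 * B.
  apply: cvgD; first exact: cvg_cst.
  by apply: cvgM; [exact/cvg_at_right_filter/cvg_id|exact: cvg_cst].
rewrite -[leRHS]addr0 -[X in _ + X](mul0r B).
apply: (ler_cvg_to lim1 lim2); near=> t.
have t0 : 0 < t by near: t; exact: nbhs_right_gt.
rewrite ler_pdivrMl//; apply: slope; rewrite t0 /=.
by near: t; exact: nbhs_right_le.
Unshelve. all: by end_near. Qed.

Lemma gt_gradient_le x d i : K x -> `|d| <= beta ->
  dotv (grad (fun y => g y 0 i) x) d <= gt d x 0 i - g x 0 i.
Proof.
move=> Kx db; rewrite -(A9 AA i Kx).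
apply: (@slope_le _ _ _ 0); first exact: gt_differentiable0.
move=> t /andP[t0 t1]; have b0 : `|0 : 'rV[R]_n| <= beta by rewrite normr0 ltW.
have t01 : 0 <= t <= 1 by rewrite ltW.
have := gt_convex i Kx t01 db b0; rewrite scaler0 addr0 gt_at0//; lra.
Qed.

Lemma ft_gradient_le c x d :
  strongly_convex_model c -> K x -> `|d| <= beta ->
  dotv (grad f x) d <= ft d x - ft 0 x - c / 2 * enorm d ^+ 2.
Proof.
move=> cvxc Kx db; rewrite -(A4 AA Kx).
apply: (@slope_le _ _ _ (c / 2 * enorm d ^+ 2)); first exact: ft_differentiable0.
move=> t /andP[t0 t1]; have b0 : `|0 : 'rV[R]_n| <= beta by rewrite normr0 ltW.
have t01 : 0 <= t <= 1 by rewrite ltW.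
by have := cvxc t d 0 x Kx t01 db b0; rewrite scaler0 addr0 subr0; lra.
Qed.

Lemma uniform_taylor l : K l -> exists2 C, 0 <= C & exists2 r, 0 < r &
  forall x z, K x -> K z -> `|x - l| < r -> `|z - l| < r ->
  [/\ f z <= f x + dotv (grad f x) (z - x) + C * `|z - x| ^+ 2,
      forall i, g z 0 i <=
        g x 0 i + dotv (grad (fun y => g y 0 i) x) (z - x) + C * `|z - x| ^+ 2 &
      forall j, `|h z 0 j - (h x 0 j + ((z - x) *m 'J h x) 0 j)| <=
        C * `|z - x| ^+ 2].
Proof.
move=> Kl.
pose F (c : unit + ('I_m + 'I_p)) y : R :=
  match c with inl _ => f y | inr (inl i) => g y 0 i | inr (inr j) => h y 0 j end.
pose P c C r := forall y z, `|y - l| < r -> `|z - l| < r ->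
  `|F c z - F c y - dotv (grad (F c) y) (z - y)| <= C * `|z - y| ^+ 2.
have [|c|C C0 [r r0 CrP]] := @uniform_local_bound R _ P.
- move=> c C C' r r' CC' rr' PCr y z yl zl.
  rewrite (le_trans (PCr y z _ _)) ?(lt_le_trans _ rr')//.
  by rewrite ler_wpM2r ?sqr_ge0.
- case: c => [u|[i|j]].
  + have [U [oU KU [[df _] lipf]]] := fC11.
    exact: (C1_taylor oU (KU _ Kl) df lipf).
  + have [U [oU KU [dg _ lipJ]]] := gC11.
    apply: (C1_taylor oU (KU _ Kl)).
      by move=> x Ux; apply: differentiable_fcoord; exact: dg.
    exact: locally_lipschitz_grad_coord.
  + have [U [oU KU [dh _ lipJ]]] := hC11.
    apply: (C1_taylor oU (KU _ Kl)).
      by move=> x Ux; apply: differentiable_fcoord; exact: dh.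
    exact: locally_lipschitz_grad_coord.
exists C => //; exists r => // x z Kx Kz xl zl; split=> [|i|j].
- have := CrP (inl tt) x z xl zl; rewrite ler_norml => /andP[_] /=; lra.
- have := CrP (inr (inl i)) x z xl zl; rewrite ler_norml => /andP[_] /=; lra.
- have := CrP (inr (inr j)) x z xl zl => /=.
  by rewrite grad_coord ?opprD ?addrA//; exact: h_differentiable.
Qed.

(** The condition [t * C <= 1] expresses that the step is short enough for the
    local estimates in a way that is antitone in [C]; thus the whole predicate
    is monotone in [C], and [C] can be increased to be common to all
    iterates. *)
Definition merit_bound c C x :=
  - C <= f x + q x /\
  forall t, 0 <= t <= 1 -> t * C <= 1 ->
  let z := x + t *: dsol x in
  f z + q z <= f x + q x + t * (C * (phi x - kappa x) - c / 2 * `|dsol x| ^+ 2)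
    + C * (t ^+ 2 * `|dsol x| ^+ 2) /\
  phi z <= phi x - t * (phi x - kappa x) + C * (t ^+ 2 * `|dsol x| ^+ 2).

Lemma merit_bound_mono c C C' x : K x -> C <= C' ->
  merit_bound c C x -> merit_bound c C' x.
Proof.
move=> Kx CC' [low H]; split; first by rewrite (le_trans _ low)// lerN2.
move=> t t01 tC'; have /andP[t0 t1] := t01.
have tC : t * C <= 1 by rewrite (le_trans _ tC')// ler_wpM2l.
have [Hf Hphi] := H t t01 tC.
have gap : C * (phi x - kappa x) <= C' * (phi x - kappa x).
  by rewrite ler_wpM2r// subr_ge0 kappa_le_phi.
have sq : C * (t ^+ 2 * `|dsol x| ^+ 2) <= C' * (t ^+ 2 * `|dsol x| ^+ 2).
  by rewrite ler_wpM2r// mulr_ge0// sqr_ge0.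
split; last by rewrite (le_trans Hphi)// lerD2l.
rewrite (le_trans Hf)// lerD// lerD2l ler_wpM2l// lerD2r//.
Qed.

(** The linearized constraints at [t *: dsol x] are convex combinations of the
    constraint values at [x], bounded by [phi x], and of the model constraints
    at [dsol x], bounded by [kappa x]; here [C] stands for the second-order
    error. *)
Lemma phi_step x t C : K x -> 0 <= t <= 1 -> 0 <= C ->
  let d := dsol x in let z := x + t *: d in
  (forall i, g z 0 i <=
     g x 0 i + t * dotv (grad (fun y => g y 0 i) x) d + C) ->
  (forall j, `|h z 0 j - (h x 0 j + t * (d *m 'J h x) 0 j)| <= C) ->
  phi z <= phi x - t * (phi x - kappa x) + C.
Proof.
move=> Kx t01 C0 d z gz hz; have /andP[t0 t1] := t01.
have [dk db Kd] := dsol_feasible Kx; rewrite -/d in dk db Kd.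
have t1' : 0 <= 1 - t by rewrite subr_ge0.
have -> : phi x - t * (phi x - kappa x) + C = (1 - t) * phi x + t * kappa x + C by ring.
apply/max_violation_le; split=> [|i|j].
- by rewrite !addr_ge0// mulr_ge0// ?kappa_ge0// max_violation_ge0.
- apply: (le_trans (gz i)); rewrite lerD2r.
  have H1 : t * dotv (grad (fun y => g y 0 i) x) d <= t * (gt d x 0 i - g x 0 i).
    by rewrite ler_wpM2l// gt_gradient_le.
  have H2 : t * gt d x 0 i <= t * kappa x.
    by rewrite ler_wpM2l// (le_trans _ dk)//; exact: le_max_violation_l.
  have H3 : (1 - t) * g x 0 i <= (1 - t) * phi x.
    by rewrite ler_wpM2l//; exact: le_max_violation_l.
  lra.
- have hE : h x 0 j + t * (d *m 'J h x) 0 j =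
      (1 - t) * h x 0 j + t * ht h d x 0 j.
    have -> : ht h d x 0 j = h x 0 j + (d *m 'J h x) 0 j by rewrite [LHS]mxE.
    by ring.
  rewrite -[h z 0 j](subrK (h x 0 j + t * (d *m 'J h x) 0 j)).
  rewrite (le_trans (ler_normD _ _))// addrC lerD// hE.
  rewrite (le_trans (ler_normD _ _))// !normrM (ger0_norm t0) (ger0_norm t1').
  rewrite lerD// ler_wpM2l//; first exact: le_max_violation_r.
  by rewrite (le_trans _ dk)//; exact: le_max_violation_r.
Qed.

Lemma f_continuous x : K x -> {for x, continuous f}.
Proof.
move=> Kx; have [U [oU KU [[df _] _]]] := fC11.
by apply: differentiable_continuous; exact/df/KU.
Qed.

(** The radius is such that both [x] and the next point stay in the ball where
    the second-order estimates hold: the step has length at most [t * beta]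
    and [C] exceeds [2 * beta / rt]. *)
Lemma local_merit_bound c l :
  strongly_convex_model c -> 0 <= c -> eMFCQ l -> exists C, exists2 r, 0 < r &
  forall x, K x -> `|x - l| < r -> merit_bound c C x.
Proof.
move=> cvxc c0 emf; have Kl := emf.1.
have [Ct Ct0 [rt rt0 taylor]] := uniform_taylor Kl.
have [Cg Cg0 [rg rg0 cost]] := cost_bounded_by_gap emf.
have [rl rl0 low] : exists2 r, 0 < r &
    forall x, `|x - l| < r -> f l + q l - 1 < f x + q x.
  have cvgl : f x + q x @[x --> l] --> f l + q l.
    exact: (cvgD (f_continuous Kl) (q_continuous Kl)).
  have [|r /= r0 Hr] := (nbhs_ballP _ _).1 (cvgr_gt _ cvgl (f l + q l - 1) _).
    by rewrite gtrBl.
  by exists r => // x xl; apply: Hr; rewrite -ball_normE /= distrC.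
have slope0 : 0 <= 2 * beta / rt by rewrite divr_ge0// ?mulr_ge0 ?ltW.
pose C := Ct + Cg + (2 * beta / rt + (`|f l + q l| + 1)).
have CtC : Ct <= C by rewrite /C; have := normr_ge0 (f l + q l); lra.
have CgC : Cg <= C by rewrite /C; have := normr_ge0 (f l + q l); lra.
have CrC : 2 * beta / rt < C by rewrite /C; have := normr_ge0 (f l + q l); lra.
exists C; exists (Num.min (rt / 2) (Num.min rg rl)).
  by rewrite !lt_min rg0 rl0 divr_gt0.
move=> x Kx; rewrite !lt_min => /andP[xt /andP[xg xl]]; split.
  have := low x xl; have := ler_norm (- (f l + q l)).
  rewrite normrN /C; lra.
move=> t t01 tC z; have /andP[t0 t1] := t01.
have [_ db Kd] := dsol_feasible Kx; set d := dsol x in db Kd z *.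
have Kz : K z.
  have := convexK t01 Kd Kx; congr K.
  by apply/rowP => i; rewrite !mxE; ring.
have zx : z - x = t *: d by rewrite /z addrC addKr.
have zl : `|z - l| < rt.
  rewrite -(subrKA x) (le_lt_trans (ler_normD _ _))// zx normrZ ger0_norm//.
  have : t * `|d| < rt / 2.
    have [->|t_neq0] := eqVneq t 0; first by rewrite mul0r divr_gt0.
    have tgt0 : 0 < t by rewrite lt0r t_neq0.
    rewrite (@le_lt_trans _ _ (t * beta))//; first by rewrite ler_wpM2l.
    have : t * (2 * beta / rt) < 1 by rewrite (lt_le_trans _ tC)// ltr_pM2l.
    by rewrite mulrA ltr_pdivrMr// mul1r; lra.
  by move: xt; lra.
have xrt : `|x - l| < rt by move: xt; lra.
have [fz gz hz] := taylor x z Kx Kz xrt zl.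
have sqE : `|z - x| ^+ 2 = t ^+ 2 * `|d| ^+ 2.
  by rewrite zx normrZ exprMn ger0_norm.
rewrite sqE zx in fz gz hz.
have sq0 : 0 <= t ^+ 2 * `|d| ^+ 2 by rewrite mulr_ge0 ?sqr_ge0.
have sqC : Ct * (t ^+ 2 * `|d| ^+ 2) <= C * (t ^+ 2 * `|d| ^+ 2) by rewrite ler_wpM2r.
split.
  rewrite dotvZr in fz.
  have gradf := ft_gradient_le cvxc Kx db.
  have qz : q z <= t * q (x + d) + (1 - t) * q x.
    have := q_convex t01 Kd Kx; congr (q _ <= _).
    by apply/rowP => i; rewrite !mxE; ring.
  have gap0 : 0 <= phi x - kappa x by rewrite subr_ge0 kappa_le_phi.
  have costx := cost x Kx xg; rewrite -/d /cost_change [x + d - x]addrC addKr in costx.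
  have costC : Cg * (phi x - kappa x) <= C * (phi x - kappa x) by rewrite ler_wpM2r.
  have norms : c / 2 * `|d| ^+ 2 <= c / 2 * enorm d ^+ 2.
    rewrite ler_wpM2l ?divr_ge0// lerXn2r ?nnegrE ?norm_le_enorm//.
    exact: sqrtr_ge0.
  have step : t * (dotv (grad f x) d + q (x + d) - q x) <=
      t * (C * (phi x - kappa x) - c / 2 * `|d| ^+ 2).
    by rewrite ler_wpM2l//; lra.
  by lra.
apply: phi_step => //.
- by rewrite mulr_ge0// (le_trans Ct0).
- move=> i; have := gz i; rewrite dotvZr => /le_trans; apply.
  by rewrite lerD2l.
- move=> j; rewrite (le_trans _ sqC)// (le_trans _ (hz j))//.
  by rewrite -scalemxAl [in leRHS]mxE.
Qed.

(** If no constant works from some index on, the iterates at which the integer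
    constants fail cluster at a limit point, which contradicts the local
    estimate there. *)
Lemma eventual_merit_bound c (x : nat -> 'rV[R]_n) B :
  strongly_convex_model c -> 0 <= c ->
  (forall k, K (x k)) -> (forall k, `|x k| <= B) ->
  (forall l, subseq_limit x l -> eMFCQ l) ->
  exists2 C, 0 <= C & exists N : nat, forall k, (N <= k)%N -> merit_bound c C (x k).
Proof.
move=> cvxc c0 Kx xB emf; apply: contrapT => nobound.
have step (j : nat) : exists k, (j <= k)%N /\ ~ merit_bound c j%:R (x k).
  apply: contrapT => /forallNP nok; apply: nobound; exists j%:R => //; exists j.
  by move=> k jk; apply: contrapT => nb; apply: (nok k).
have [s sP] := choice step.
have [|l _ sl] := @compact_cluster_value _ _ (cball 0 B) (x \o s) (@compact_cball _ _ _ _).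
  by move=> j; rewrite /cball /= subr0.
have xl : cluster_value x l.
  move=> e e0 N; have [j Nj xj] := sl e e0 N; exists (s j) => //.
  by rewrite (leq_trans Nj)//; have [] := sP j.
have [C [r r0 bound]] := local_merit_bound cvxc c0 (emf l ((subseq_limitP _ _).2 xl)).
have [j Cj xj] := sl r r0 (Num.truncn `|C|).+1.
have [_] := sP j; apply; apply: merit_bound_mono (bound _ (Kx _) xj) => //.
rewrite (le_trans (ler_norm C))// (le_trans (ltW (truncnS_gt _)))// ler_nat//.
Qed.

(** * Global convergence *)

Section global_convergence.
Variables (gamma : nat -> R) (x0 : 'rV[R]_n) (x : nat -> 'rV[R]_n).
Hypothesis gamma01 : forall k, 0 < gamma k <= 1.
Hypothesis gamma_to0 : gamma @ \oo --> (0 : R).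
Hypothesis gamma_sum : series gamma @ \oo --> +oo.
Hypothesis Kx0 : K x0.
Hypothesis dsm : DSM_sequence K f q g h ft gt beta rho lambda gamma x0 x.

Let gamma_gt0 k : 0 < gamma k. Proof. by have /andP[] := gamma01 k. Qed.

Lemma DSM_step k : x k.+1 = x k + gamma k *: dsol (x k).
Proof. by case: dsm => _ /(_ k)[]. Qed.

(** [x k.+1] lies between [x k] and [x k + dsol (x k)]. *)
Lemma DSM_in_K k : K (x k).
Proof.
elim: k => [|k Kxk]; first by case: dsm => ->.
have [_ _ Kd] := dsol_feasible Kxk; rewrite DSM_step.
have /andP[g0 g1] := gamma01 k.
have g01 : 0 <= gamma k <= 1 by rewrite ltW.
have := convexK g01 Kd Kxk; congr K.
by apply/rowP => i; rewrite !mxE; ring.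
Qed.

Lemma limit_in_K l : subseq_limit x l -> K l.
Proof. by move=> /subseq_limitP; exact: closed_cluster_value clK DSM_in_K. Qed.

Lemma eMFCQ_of_nonstationary l : K l -> ~ stationary K f q g h l -> eMFCQ l.
Proof.
move=> Kl nstat; split => //; apply: contrapT => M0n; apply: nstat.
have [[gl hl]|infeas] := pselect (feasible g h l); first by apply: Or32; split.
apply: Or33; split => //; apply: contrapT => /not_orP[/forallNP gl /forallNP hl].
apply: infeas; split=> [i|].
  by rewrite leNgt; apply/negP; exact: gl.
by apply/rowP => j; rewrite mxE; apply: contrapT; exact: hl.
Qed.

Lemma stationary_eMFCQ_KKT l : stationary K f q g h l -> eMFCQ l -> KKT l.
Proof. by case=> [//|[_ _ M0n]|[_ _ M0n]] [_ M0l]. Qed.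

(** With the penalty weight [C] the gaps [phi - kappa] cancel, and the
    second-order terms are absorbed by half of the strong convexity term as
    soon as [gamma k * (C + C * C)] is below [c / 4]. *)
Lemma DSM_merit_decrease B : (forall k, `|x k| <= B) ->
  (forall l, subseq_limit x l -> eMFCQ l) ->
  exists W : nat -> R, exists c, exists b, exists N : nat, [/\ 0 < c,
    forall k, (N <= k)%N -> W k.+1 <= W k - c * gamma k * `|dsol (x k)| ^+ 2 &
    forall k, (N <= k)%N -> - b <= W k].
Proof.
move=> xB emf; have [c c0 cvxc] := ft_strongly_convex.
have [C C0 [N bound]] := eventual_merit_bound cvxc (ltW c0) DSM_in_K xB emf.
have small : gamma k * (C + C * C) @[k --> \oo] --> 0 * (C + C * C).
  by apply: cvgM; [exact: gamma_to0|exact: cvg_cst].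
have small' : gamma k * C @[k --> \oo] --> 0 * C.
  by apply: cvgM; [exact: gamma_to0|exact: cvg_cst].
rewrite mul0r in small; rewrite mul0r in small'.
have [|N1 _ HN1] := cvgr_lt _ small (c / 4); first by rewrite divr_gt0.
have [|N2 _ HN2] := cvgr_lt _ small' 1; first exact: ltr01.
exists (fun k => f (x k) + q (x k) + C * phi (x k)), (c / 4), C.
exists (maxn N (maxn N1 N2)); split; first by rewrite divr_gt0.
  move=> k; rewrite !geq_max => /and3P[Nk N1k N2k].
  have [_ /(_ (gamma k))] := bound k Nk.
  have /andP[g0 g1] := gamma01 k.
  rewrite ltW// => /(_ g1 (ltW (HN2 k N2k))) /=; rewrite -DSM_step => -[Hf Hphi].
  have : C * phi (x k.+1) <= C * (phi (x k) - gamma k * (phi (x k) - kappa (x k)) +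
      C * (gamma k ^+ 2 * `|dsol (x k)| ^+ 2)) by rewrite ler_wpM2l.
  have : (gamma k * (C + C * C)) * (gamma k * `|dsol (x k)| ^+ 2) <=
      c / 4 * (gamma k * `|dsol (x k)| ^+ 2).
    by rewrite ler_wpM2r ?(ltW (HN1 k N1k))// mulr_ge0 ?sqr_ge0// ltW.
  have : 0 <= c * (gamma k * `|dsol (x k)| ^+ 2).
    by rewrite !mulr_ge0 ?sqr_ge0// ltW.
  move: Hf; set P1 := phi (x k); set P2 := phi _; set D := `|dsol (x k)|.
  set A1 := f (x k); set A2 := q (x k); set G := gamma k; set Q := kappa _.
  by move=> Hf Hc Hsmall HC; lra.
move=> k; rewrite !geq_max => /andP[Nk _].
have [low _] := bound k Nk.
by rewrite (le_trans low)// lerDl mulr_ge0// max_violation_ge0.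
Qed.

(** A limit point that is not stationary satisfies eMFCQ; if this held for all
    of them, a subsequence along which the directions tend to 0 would lead to
    a KKT point. *)
Lemma DSM_some_limit_stationary B : (forall k, `|x k| <= B) ->
  exists2 l, subseq_limit x l & stationary K f q g h l.
Proof.
move=> xB; apply: contrapT => nostat.
have emf l : subseq_limit x l -> eMFCQ l.
  move=> xl; apply: eMFCQ_of_nonstationary; first exact: limit_in_K.
  by move=> stat; apply: nostat; exists l.
have [W [c [b [N [c0 dec low]]]]] := DSM_merit_decrease xB emf.
have step (j : nat) : exists k, (j <= k)%N /\ `|dsol (x k)| < j.+1%:R^-1.
  have [|k jk dk] := arbitrarily_small_steps (d := fun k => dsol (x k))
    c0 gamma_gt0 gamma_sum dec low (e := j.+1%:R^-1) j.
    by rewrite invr_gt0.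
  by exists k.
have [s sP] := choice step.
have [|l _ [s' s'_incr xl]] :=
    @compact_subseq _ _ (cball 0 B) (x \o s) (@compact_cball _ _ _ _).
  by move=> j; rewrite /cball /= subr0.
have d0 : dsol (x (s j)) @[j --> \oo] --> (0 : 'rV[R]_n).
  by apply: cvg_dist_lt_harmonic => j; rewrite subr0; have [] := sP j.
have limit_l : subseq_limit x l.
  apply/subseq_limitP => e e0 M.
  have [j Mj xj] := (subseq_limitP _ _).1 (ex_intro2 _ _ s' s'_incr xl) e e0 M.
  by exists (s j) => //; rewrite (leq_trans Mj)//; have [] := sP j.
apply: nostat; exists l => //; apply: Or31.
apply: (@KKT_limit l (x \o s \o s') (emf l limit_l)) => //.
  by move=> k; exact: DSM_in_K.
exact: cvg_comp (subseq_cvgn s'_incr) d0.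
Qed.

Lemma DSM_all_limits_KKT B : (forall k, `|x k| <= B) ->
  (forall l, subseq_limit x l -> eMFCQ l) ->
  assumptionB K q g h ft gt beta rho lambda ->
  forall l, subseq_limit x l -> KKT l.
Proof.
move=> xB emf holder l xl; have [s s_incr xs] := xl.
have [W [c [b [N [c0 dec low]]]]] := DSM_merit_decrease xB emf.
have [||mu [alpha [mu0 alpha0 hol]]] := holder (cball 0 B `&` K).
- by apply: compact_closedI => //; exact: compact_cball.
- by move=> y [].
have d0 : dsol (x k) @[k --> \oo] --> (0 : 'rV[R]_n).
  apply: (steps_vanish (d := fun k => dsol (x k)) c0 gamma_gt0 gamma_sum dec low DSM_step).
  move=> e e0; pose r := (e / mu) `^ alpha^-1.
  have r0 : 0 < r by rewrite powR_gt0// divr_gt0.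
  exists (r / n.+1%:R); first by rewrite divr_gt0.
  move=> j k xjk.
  have xS i : (cball 0 B `&` K) (x i) by split; [rewrite /cball /= subr0|exact: DSM_in_K].
  rewrite (le_trans (norm_le_enorm _))// (le_trans (hol _ _ (xS j) (xS k)))//.
  apply: holder_modulus => //; first exact: sqrtr_ge0.
  rewrite (le_trans (enorm_le_norm _))// (@le_trans _ _ (n.+1%:R * `|x j - x k|))//.
    by rewrite ler_wpM2r// ler_nat.
  by rewrite mulrC -ler_pdivlMr.
apply: (@KKT_limit l (x \o s) (emf l xl)) => //.
  by move=> k; exact: DSM_in_K.
exact: cvg_comp (subseq_cvgn s_incr) d0.
Qed.

End global_convergence.

End subproblem.

Theorem theorem4p1 (R : realType) (n m p : nat)
  (K : set 'rV[R]_n) (f q : 'rV[R]_n -> R)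
  (g : 'rV[R]_n -> 'rV[R]_m) (h : 'rV[R]_n -> 'rV[R]_p)
  (beta rho lambda : R)
  (ft : 'rV[R]_n -> 'rV[R]_n -> R) (gt : 'rV[R]_n -> 'rV[R]_n -> 'rV[R]_m)
  (Od Ox : set 'rV[R]_n)
  (gamma : nat -> R) (x0 : 'rV[R]_n) (x : nat -> 'rV[R]_n) :
  K !=set0 -> closed K -> convex_set K ->
  (exists U, [/\ open U, K `<=` U & C11_on U f]) ->
  (exists U, [/\ open U, K `<=` U & C11_map_on U g]) ->
  (exists U, [/\ open U, K `<=` U & C11_map_on U h]) ->
  convex_function K q ->
  (exists U, [/\ open U, K `<=` U & locally_lipschitz_on U (q : _ -> R^o)]) ->
  0 < beta -> 0 < rho < beta -> 0 < lambda < 1 ->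
  assumptionA K f g ft gt beta Od Ox ->
  (forall k, 0 < gamma k <= 1) ->
  gamma @ \oo --> (0 : R) ->
  series gamma @ \oo --> +oo ->
  K x0 ->
  DSM_sequence K f q g h ft gt beta rho lambda gamma x0 x ->
  (forall k, K (x k)) /\
  (~ bounded_fun x \/
   ((exists xhat, [/\ subseq_limit x xhat,
        stationary K f q g h xhat &
        eMFCQ K g h xhat -> KKT K f q g h xhat]) /\
    ((forall xhat, subseq_limit x xhat -> eMFCQ K g h xhat) ->
     assumptionB K q g h ft gt beta rho lambda ->
     forall xhat, subseq_limit x xhat -> KKT K f q g h xhat))).
Proof.
move=> _ clK cvxK fC11 gC11 hC11 cvxq qlip beta0 rhob lam01 AA gamma01 gamma_to0
  gamma_sum Kx0 dsm.
split; first by move=> k; eapply DSM_in_K; eassumption.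
have [[M [_ xM]]|] := pselect (bounded_fun x); last by left.
right; have xB k : `|x k| <= M + 1 by apply: (xM (M + 1) _ k I); rewrite ltrDl.
split; last by move=> emf holder; eapply DSM_all_limits_KKT; eassumption.
have [xhat xxhat stat] : exists2 l, subseq_limit x l & stationary K f q g h l.
  by eapply DSM_some_limit_stationary; eassumption.
by exists xhat; split=> //; exact: stationary_eMFCQ_KKT.
Qed.
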